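(* For $n\ge 1$ let $C_n(q,t)=\sum_D q^{\mathrm{area}(D)}t^{\mathrm{dinv}(D)}$, where $D$ ranges over Dyck sequences of length $n$. Then \[ C_n(q,t)=\sum_{(F,P)} q^{\mathrm{area}(F:\mathrm{RR}(P))}\,t^{\mathrm{dinv}(F:\mathrm{RR}(P))-|P|}\,s_{\lambda(P)'}(q,t). \] The sum is over all pairs $(F,P)$ such that $F$ is a Dyck $m$-skeleton for some $m\ge 0$, $P$ is an at-most-two-column Dyck tableau with entries in $[0,m-1]$, and $|F|+|\mathrm{RR}(P)|=n$. Here $\lambda(P)$ is the shape of $P$, $\lambda(P)'$ is its conjugate partition, and $s_{\lambda(P)'}(q,t)$ is the Schur function in the two variables $q,t$.
   Context: Sequences are finite integer sequences indexed from $0$, possibly empty; $|x|$ is the length of a sequence $x$; $A:B$ denotes concatenation. For $x=(x_0,\ldots,x_{r-1})$: $\mathrm{di}(x)=\#\{i<j: x_i=x_j+1\}$, $\mathrm{nv}(x)=\#\{i<j:x_i=x_j\}$, $\mathrm{dinv}(x)=\mathrm{di}(x)+\mathrm{nv}(x)$, and $\mathrm{area}(x)=\sum_i x_i$. A Dyck sequence is a nonempty sequence with $x_0=0$, all entries nonnegative, and $x_{i+1}\le x_i+1$ for all $i$. In a Dyck sequence $C=(c_0,\ldots,c_{r-1})$, an index $j$ is eligible if (i) there is exactly one index $i<j$ with $c_i=c_j-1$, and (ii) if $j+1<r$ then $c_{j+1}\le c_j$. For $m\ge0$, a Dyck sequence $F$ of length $r$ is a Dyck $m$-skeleton if $\max(F)=m$,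 the last entry of $F$ equals $m$, and $F$ has no eligible index $j<r-1$ (no ''nonfinal extractable element''; the last index may be eligible). A Dyck tableau is a left-aligned tableau with rows $T_0,\ldots,T_{\ell-1}$ from top to bottom (nonempty rows; the empty tableau is allowed), with weakly decreasing row lengths $|T_0|\ge\cdots\ge|T_{\ell-1}|$, such that each row $T=(T[0],T[1],\ldots)$ satisfies $T[p+1]\ge T[p]+2$, and whenever adjacent rows $T_j,T_{j+1}$ both have an entry in column $p$, $T_j[p]\le T_{j+1}[p]+1$. $\mathrm{RR}(P)=T_{\ell-1}T_{\ell-2}\cdots T_0$ (rows read left to right, bottom row first), $\lambda(P)$ is the partition of row lengths, and $|P|$ is the number of cells. If $m=0$ the interval $[0,m-1]$ is empty, so $P$ must be empty. *)

(* Defs.v *)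
From mathcomp Require Import all_boot all_order all_algebra.
From mathcomp Require Import boolp classical_sets functions cardinality fsbigop.
From mathcomp Require Import mpoly.

Set Implicit Arguments.
Unset Strict Implicit.
Unset Printing Implicit Defensive.

Local Open Scope classical_set_scope.

(* All sequences below have nonnegative entries, so they are taken in
   [seq nat]; equations such as c_i = c_j - 1 are written additively to avoid
   truncated subtraction. *)

Definition di (x : seq nat) : nat :=
  #|[set ij : 'I_(size x) * 'I_(size x) |
      (ij.1 < ij.2) && (nth 0 x ij.1 == (nth 0 x ij.2).+1)]%SET|.

Definition nv (x : seq nat) : nat :=
  #|[set ij : 'I_(size x) * 'I_(size x) |
      (ij.1 < ij.2) && (nth 0 x ij.1 == nth 0 x ij.2)]%SET|.

Definition dinv (x : seq nat) : nat := di x + nv x.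

Definition area (x : seq nat) : nat := sumn x.

Definition is_dyck (x : seq nat) : bool :=
  [&& x != [::], nth 0 x 0 == 0 & sorted [rel a b | b <= a.+1] x].

Definition eligible (C : seq nat) (j : nat) : bool :=
  [&& j < size C,
      #|[set i : 'I_j | (nth 0 C i).+1 == nth 0 C j]%SET| == 1 &
      (j.+1 < size C) ==> (nth 0 C j.+1 <= nth 0 C j)].

Definition is_skeleton (m : nat) (F : seq nat) : Prop :=
  [/\ is_dyck F,
      \max_(a <- F) a = m,
      last 0 F = m &
      forall j, j.+1 < size F -> ~~ eligible F j].

(* A tableau is the list of its rows, from top to bottom.  [zip R S] lists the
   columns in which both R and S have an entry. *)
Definition is_dyck_tableau (P : seq (seq nat)) : bool :=
  [&& [::] \notin P,
      sorted geq (map size P),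
      all (sorted [rel a b | a.+2 <= b]) P &
      sorted [rel R S : seq nat | all (fun ab => ab.1 <= ab.2.+1) (zip R S)] P].

Definition RR (P : seq (seq nat)) : seq nat := flatten (rev P).

Definition shape_of (P : seq (seq nat)) : seq nat := map size P.

Definition ncells (P : seq (seq nat)) : nat := sumn (shape_of P).

(* Partitions are weakly decreasing lists of positive parts. *)
Definition conj_partition (la : seq nat) : seq nat :=
  mkseq (fun j => count (fun r => j < r) la) (head 0 la).

(* Semistandard Young tableaux of shape [la] with entries in {0, ..., k-1}. *)
Definition is_ssyt (k : nat) (la : seq nat) (T : seq (seq nat)) : bool :=
  [&& map size T == la,
      all (all (fun a => a < k)) T,
      all (sorted leq) T &
      sorted [rel R S : seq nat | all (fun ab => ab.1 < ab.2) (zip R S)] T].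

Section Polynomials.
Local Open Scope ring_scope.

Definition schur (k : nat) (la : seq nat) : {mpoly int[k]} :=
  \sum_(T \in [set T | is_ssyt k la T])
    \prod_(i < k) ('X_i : {mpoly int[k]}) ^+ count_mem (i : nat) (flatten T).

Definition q : {mpoly int[2]} := 'X_ord0.
Definition t : {mpoly int[2]} := 'X_ord_max.

Definition qtCatalan (n : nat) : {mpoly int[2]} :=
  \sum_(D \in [set D | is_dyck D /\ size D = n]) q ^+ area D * t ^+ dinv D.

End Polynomials.

Definition skeleton_pairs (n : nat) : set (seq nat * seq (seq nat)) :=
  [set FP | exists m : nat,
    [/\ is_skeleton m FP.1,
        is_dyck_tableau FP.2,
        all (fun R => size R <= 2) FP.2,
        all (all (fun a => a < m)) FP.2 &
        (size FP.1 + size (RR FP.2) = n)%N]].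

(* The sums above range over finite sets, so that [\sum_(_ \in _)] never takes
   its default value. *)

Lemma finite_seqs (T : eqType) (A : set T) (M : nat) :
  finite_set A ->
  finite_set [set s : seq T | size s <= M /\ (forall a, a \in s -> A a)].
Proof.
move=> fA; elim: M => [|M IH].
  by apply: (@sub_finite_set _ _ [set [::]]) => // s /= []; case: s.
have fX := finite_setX fA IH.
apply: (@sub_finite_set _ _ ([set [::]] `|`
   ((fun p => p.1 :: p.2) @` (A `*` [set s | size s <= M /\ forall a, a \in s -> A a])))).
  move=> [|a s] /= [sz sA]; first by left.
  right; exists (a, s) => //=; split => /=; first by apply: sA; rewrite mem_head.
  by split => // b bs; apply: sA; rewrite inE bs orbT.
by rewrite finite_setU; split => //; apply: finite_image.
Qed.

Lemma finite_ltn (k : nat) : finite_set [set a : nat | a < k].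
Proof. exact: finite_II. Qed.

Lemma dyck_nth (x : seq nat) (i : nat) : is_dyck x -> i < size x -> nth 0 x i <= i.
Proof.
case/and3P => _ /eqP x0 /(sortedP 0) st; elim: i => [|i IH] ilt; first by rewrite x0.
apply: leq_trans (st _ ilt) _; rewrite ltnS; apply: IH; exact: ltnW.
Qed.

Lemma dyck_ltn (x : seq nat) (a : nat) : is_dyck x -> a \in x -> a < size x.
Proof.
move=> dx /(nthP 0) [i ilt <-]; exact: leq_ltn_trans (dyck_nth dx ilt) ilt.
Qed.

Lemma finite_dyck (n : nat) : finite_set [set D | is_dyck D /\ size D = n].
Proof.
apply: sub_finite_set (finite_seqs n (finite_ltn n)) => D /= [dD <-].
by split => // a; apply: dyck_ltn.
Qed.

Lemma finite_ssyt (k : nat) (la : seq nat) : finite_set [set T | is_ssyt k la T].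
Proof.
apply: sub_finite_set
  (finite_seqs (size la) (finite_seqs (sumn la) (finite_ltn k))) => T /=.
case/and4P => /eqP <- /allP Tk _ _; split; first by rewrite size_map.
move=> R RT; split; last by move=> a aR; exact: (allP (Tk R RT)).
elim: T RT {Tk} => // S T IH; rewrite inE /= => /predU1P[->|/IH]; first exact: leq_addr.
by move=> le; apply: leq_trans le (leq_addl _ _).
Qed.

Lemma perm_RR (P : seq (seq nat)) : perm_eq (RR P) (flatten P).
Proof. by rewrite /RR; apply: perm_flatten; rewrite perm_rev. Qed.

Lemma size_RR (P : seq (seq nat)) : size (RR P) = ncells P.
Proof. by rewrite (perm_size (perm_RR P)) size_flatten. Qed.

Lemma leq_bigmax_mem (F : seq nat) (a : nat) : a \in F -> a <= \max_(b <- F) b.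
Proof. by move=> aF; rewrite (big_rem a aF) /= leq_maxl. Qed.

Lemma finite_skeleton_pairs (n : nat) : finite_set (skeleton_pairs n).
Proof.
have fF := finite_seqs n (finite_ltn n).
apply: sub_finite_set (finite_setX fF (finite_seqs n fF)) => -[F P] /=.
case=> m [[dF mF lF _] /and4P[P0 _ _ _] _ /allP Pm sz] /=.
have Fn : size F <= n by rewrite -sz leq_addr.
have Pn : size (flatten P) <= n by rewrite -(perm_size (perm_RR P)) -sz leq_addl.
have mn : m <= n.
  apply: leq_trans Fn; rewrite -mF; apply/bigmax_leqP_seq => a aF _.
  exact: ltnW (dyck_ltn dF aF).
split; split => /=.
- by [].
- by move=> a aF; exact: leq_trans (dyck_ltn dF aF) Fn.
- apply: leq_trans Pn; move: P0; clear; elim: P => //= R P IH.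
  rewrite inE negb_or size_cat => /andP[R0 /IH le].
  by rewrite -add1n leq_add // lt0n size_eq0 eq_sym.
- move=> R RP; split; last first.
    by move=> a aR; apply: leq_trans (allP (Pm R RP) a aR) mn.
  apply: leq_trans Pn; rewrite size_flatten.
  move: RP; clear; elim: P => // S P IH; rewrite inE /= => /predU1P[->|/IH].
    exact: leq_addr.
  by move=> le; apply: leq_trans le (leq_addl _ _).
Qed.

(* The exponent dinv (F ++ RR P) - ncells P is never truncated. *)

Lemma dyck_ivt (F : seq nat) (a b : nat) :
  is_dyck F -> b \in F -> a <= b -> a \in F.
Proof.
move=> dF /(nthP 0)[i]; case/and3P: dF => _ /eqP F0 /(sortedP 0) st.
elim: i b => [|i IH] b ilt <- le.
  by move: le; rewrite F0 leqn0 => /eqP ->; rewrite -[X in X \in _]F0 mem_nth.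
move: le; rewrite leq_eqVlt => /predU1P[->|lt]; first exact: mem_nth.
apply: (IH (nth 0 F i)) => //; first exact: ltnW.
by rewrite -ltnS; apply: leq_trans lt (st _ ilt).
Qed.

Lemma leq_ncells_dinv (n : nat) (F : seq nat) (P : seq (seq nat)) :
  skeleton_pairs n (F, P) -> ncells P <= dinv (F ++ RR P).
Proof.
case=> m [[/= dF mF lF _] _ _ /allP Pm _].
have mF' : m \in F.
  rewrite -lF; case: F dF {mF lF} => [|a F] // _; exact: mem_last.
have RRm a : a \in RR P -> a.+1 \in F.
  rewrite (perm_mem (perm_RR P)) => /flattenP[R RP aR].
  exact: dyck_ivt dF mF' (allP (Pm R RP) a aR).
rewrite -size_RR; apply: leq_trans (leq_addr _ _).
set x := F ++ RR P; have sx : size x = size F + size (RR P) by rewrite size_cat.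
have lt1 (j : 'I_(size (RR P))) : index (nth 0 (RR P) j).+1 F < size F.
  by rewrite index_mem; apply: RRm; apply: mem_nth.
have lt1x (j : 'I_(size (RR P))) : index (nth 0 (RR P) j).+1 F < size x.
  by rewrite sx ltn_addr.
have lt2x (j : 'I_(size (RR P))) : size F + j < size x by rewrite sx ltn_add2l.
pose f j := (Ordinal (lt1x j), Ordinal (lt2x j)).
have injf : injective f.
  by move=> j k [_ /eqP]; rewrite eqn_add2l => /eqP /val_inj.
rewrite -[X in X <= _]card_ord -(card_imset _ injf); apply: subset_leq_card.
apply/fintype.subsetP => _ /imsetP[j _ ->]; rewrite inE /=.
rewrite (leq_trans (lt1 j) (leq_addr _ _)) /x !nth_cat lt1 ltnNge leq_addr /=.
by rewrite addKn nth_index ?eqxx // RRm // mem_nth.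
Qed.

(* Main.v *)
Require Import Defs.
From HB Require Import structures.
From mathcomp Require Import all_boot all_order all_algebra.
From mathcomp Require Import boolp classical_sets functions cardinality fsbigop.
From mathcomp Require Import mpoly zify ring.

(** A Dyck sequence factors uniquely as [s ++ w] with [s] ending at the last
    occurrence of the maximum [m].  In [s], the first nonfinal eligible letter
    [a + 1] is its first occurrence and immediately follows the first [a]
    (an earlier [a + 1], not being eligible, would start a run ascending by 1
    that never comes back to [a + 1]); removing such letters one after the other
    leads to a skeleton [F] and records a word [u] without descents larger than
    1.  Re-inserting gives [dinv (s ++ w) + size u = dinv (F ++ w ++ u)].

    It remains to sum over the pairs [(w, u)].  Let [X_a] be variables with
    [X_(a+1) X_a = t X_a X_(a+1)], commuting when the indices differ by at least
    2, so that a word evaluates to [t] to the number of its inversions [b + 1, b].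
    The sums [E_k(z)] over chains of letters below [k - 1] (here [chain_sum z k])
    satisfy [E_(k+2) = E_(k+1) + z E_k X_k] and commute with each other for fixed
    [k], and the series [h(z)] of column words in the letters below [m] is inverse
    to [E_(m+1)(-z)].
    Peeling off the top row of a two-column tableau yields a recursion whose
    solution is [h(x) h(y)] times the alternating expression
    [x E_d(-y) E_c(-x) - y E_d(-x) E_c(-y)]; for the unconstrained tableaux this is
    [(x - y) h(x) h(y) = (x - y) sum_P s_(lambda(P)')(x, y) X_(RR P)].  The [X_a] are
    realized as operators on functions of the letter counts, whose matrix
    coefficients compute [q]^area [t]^dinv. *)

Set Implicit Arguments.
Unset Strict Implicit.
Unset Printing Implicit Defensive.
Import GRing.Theory.

(** * The statistic dinv *)

(** The relation [p] is left arbitrary so that one proof serves both [di] and [nv]. *)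
Lemma card_pairs_cons (p : nat -> nat -> bool) a x :
  #|[set ij : 'I_(size (a :: x)) * 'I_(size (a :: x)) |
      (ij.1 < ij.2) && p (nth 0 (a :: x) ij.1) (nth 0 (a :: x) ij.2)]| =
  count (p a) x +
  #|[set ij : 'I_(size x) * 'I_(size x) | (ij.1 < ij.2) && p (nth 0 x ij.1) (nth 0 x ij.2)]|.
Proof.
have card_sum (y : seq nat) :
    #|[set ij : 'I_(size y) * 'I_(size y) | (ij.1 < ij.2) && p (nth 0 y ij.1) (nth 0 y ij.2)]| =
    \sum_(i < size y) \sum_(j < size y) ((i < j) && p (nth 0 y i) (nth 0 y j)).
  rewrite pair_bigA /= -sum1_card big_mkcond /=.
  by apply: congr_big => // ij _; rewrite inE; case: (_ && _).
rewrite !card_sum /= big_ord_recl big_ord_recl /= add0n; congr (_ + _).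
  rewrite -sum1_count (big_nth 0) big_mkord [RHS]big_mkcond.
  by apply: eq_bigr => j _ /=; case: (p _ _).
apply: eq_bigr => i _; rewrite big_ord_recl /= add0n.
by apply: eq_bigr => j _; rewrite ltnS.
Qed.

Lemma dinv_cons a x :
  dinv (a :: x) = count_mem a x + count (fun b => b.+1 == a) x + dinv x.
Proof.
rewrite /dinv /di /nv (card_pairs_cons (fun b c => b == c.+1)).
rewrite (card_pairs_cons (fun b c => b == c)) addnACA; congr (_ + _).
by rewrite addnC; congr (_ + _); apply: eq_count => b /=; rewrite eq_sym.
Qed.

Lemma dinv_insert x a y :
  dinv (x ++ a :: y) = dinv (x ++ y) + (count_mem a x + count_mem a.+1 x) +
                       (count_mem a y + count (fun b => b.+1 == a) y).
Proof.
elim: x => [|b x IH] /=; first by rewrite dinv_cons !addn0 addnC.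
rewrite !dinv_cons IH !count_cat /= [a == b]eq_sym [a.+1 == b]eq_sym.
set A := count_mem b x; set B := count_mem b y; lia.
Qed.

(** * Extracting eligible letters *)

Lemma dyck_cat x y : x != [::] -> is_dyck (x ++ y) -> is_dyck x.
Proof.
case: x => // a x _ /and3P[_ /= a0 st]; rewrite /is_dyck /= a0.
by move: st; rewrite cat_path => /andP[].
Qed.

(** By the intermediate value property, an entry of [x] that is at least [a] would force an [a] in
    [x]. *)
Lemma dyck_prefix_lt x a y : is_dyck (x ++ a :: y) -> a \notin x -> all (fun b => b < a) x.
Proof.
move=> dx ax; apply/allP => b bx; rewrite ltnNge; apply: contra ax => ab.
by apply: (dyck_ivt _ bx ab); apply: dyck_cat dx; apply: contraL bx => /eqP ->.
Qed.

(** Ascents are by at most 1, so every smaller letter has occurred by the time [b] first appears. *)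
Lemma dyck_index_leq s a b : is_dyck s -> b \in s -> a <= b -> index a s <= index b s.
Proof.
move=> ds bs ab; rewrite -ltnS; apply: index_ltn; apply: (@dyck_ivt _ a b) => //.
  by apply: (@dyck_cat _ (drop (index b s).+1 s)); rewrite ?cat_take_drop //; case: s ds {bs}.
by rewrite in_take.
Qed.

Lemma eligibleE C j : eligible C j =
  [&& j < size C, count (fun b => b.+1 == nth 0 C j) (take j C) == 1 &
      (j.+1 < size C) ==> (nth 0 C j.+1 <= nth 0 C j)].
Proof.
rewrite /eligible; case: ltnP => //= jC; congr ((_ == 1) && _).
rewrite -sum1_card -sum1_count (big_nth 0) size_take jC big_mkord.
by apply: eq_bigl => i; rewrite inE /= nth_take.
Qed.

(** Eligibility of [j] depends only on the entries up to position [j.+1], which is at most [k]. *)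
Lemma eq_eligible s s' k j : take k.+1 s = take k.+1 s' -> j < k ->
  k < size s -> k < size s' -> eligible s j = eligible s' j.
Proof.
move=> ss' jk ks ks'; rewrite !eligibleE.
have nthE i : i <= k -> nth 0 s i = nth 0 s' i.
  by move=> ik; rewrite -(@nth_take k.+1) // ss' nth_take.
have takeE : take j s = take j s'.
  by rewrite -(@take_takel _ j k.+1) ?ss' ?take_takel // ltnW // ltnW.
rewrite takeE !nthE //; last exact: ltnW.
by rewrite (ltn_trans jk ks) (ltn_trans jk ks') (leq_ltn_trans jk ks) (leq_ltn_trans jk ks').
Qed.

(** Cutting a Dyck sequence after the last occurrence of its maximum leaves such a prefix; skeletons
    are those without nonfinal eligible letters. *)
Definition dyck_to (m : nat) (s : seq nat) : bool :=
  [&& is_dyck s, all (fun a => a <= m) s & last 0 s == m].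

Lemma dyck_to_skeleton m F :
  is_skeleton m F <-> dyck_to m F /\ (forall j, j.+1 < size F -> ~~ eligible F j).
Proof.
split=> [[dF mF lF elF]|[/and3P[dF /allP mF /eqP lF] elF]].
  split=> //; rewrite /dyck_to dF lF eqxx andbT /=.
  by apply/allP => a aF; rewrite -mF leq_bigmax_mem.
split=> //; apply/eqP; rewrite eqn_leq; apply/andP; split.
  by apply/bigmax_leqP_seq => a /mF.
by apply: leq_bigmax_mem; rewrite -lF; case: F dF {mF lF elF} => // a F _; exact: mem_last.
Qed.

Lemma dyck_to_mem m s a : dyck_to m s -> a <= m -> a \in s.
Proof.
case/and3P=> ds _ /eqP lm am; apply: (@dyck_ivt _ a m) => //.
by rewrite -lm; case: s ds {lm} => // b s _; exact: mem_last.
Qed.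

(** Undoes an extraction. The parameter is one less than the inserted letter, so recorded words have
    letters below [m]. *)
Definition insert (a : nat) (s : seq nat) : seq nat :=
  take (index a s).+1 s ++ a.+1 :: drop (index a s).+1 s.

Lemma insert_first x a y : a \notin x -> insert a (x ++ a :: y) = x ++ a :: a.+1 :: y.
Proof.
move=> ax; rewrite /insert index_cat (negbTE ax) /= eqxx addn0.
rewrite -(size_rcons x a) -[x ++ a :: y]cat_rcons.
by rewrite take_size_cat // drop_size_cat // cat_rcons.
Qed.

Lemma split_first (s : seq nat) a : a \in s ->
  exists x y, [/\ s = x ++ a :: y, a \notin x & index a s = size x].
Proof.
move=> as_; exists (take (index a s) s), (drop (index a s).+1 s); split.
- by rewrite -{2}(nth_index 0 as_) -drop_nth ?index_mem // cat_take_drop.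
- by rewrite in_take // ltnn.
- by rewrite size_take index_mem as_.
Qed.

Lemma dyck_to_insert m s a : dyck_to m s -> a < m -> dyck_to m (insert a s).
Proof.
move=> ds am; have [x [y [es ax _]]] := split_first (dyck_to_mem ds (ltnW am)).
subst s; rewrite insert_first //; case/and3P: ds => ds mx /eqP lm.
apply/and3P; split.
- case/and3P: ds => _ h0 st; apply/and3P; split; first by case: (x).
    by case: (x) h0.
  have py c v : path [rel a b | b <= a.+1] c v -> path [rel a b | b <= a.+1] c.+1 v.
    by case: v => //= d v /andP[/leqW -> ->].
  move: st; case: (x) => [|b z] /=; first by move=> /py ->; rewrite leqnn.
  by rewrite !cat_path /= => /and3P[-> -> /py ->]; rewrite leqnn.
- by move: mx; rewrite !all_cat /= => /and3P[-> -> ->]; rewrite am.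
(* If nothing followed the first [a], the last entry would be [a], against [a < m]. *)
- rewrite !last_cat /= in lm *; case: (y) lm => [|c v] /= e; last by rewrite e.
  by move: am; rewrite -e ltnn.
Qed.

Lemma dyck_step x a y : sorted [rel a b | b <= a.+1] (x ++ a :: y) -> head 0 y <= a.+1.
Proof.
case: x => [|b x] /=; first by case: y => //= c y /andP[].
by rewrite cat_path; case: y => //= c y /and4P[].
Qed.

(** The new [a.+1] has exactly one [a] before it, and the next entry, having followed [a], is at
    most [a.+1]. The first [a] is now followed by a larger letter, and earlier positions are
    unaffected. *)
Lemma insert_eligible m s a : dyck_to m s -> a < m ->
  (forall j, j < index a s -> ~~ eligible s j) ->
  [/\ (index a s).+2 < size (insert a s), nth 0 (insert a s) (index a s).+1 = a.+1,
      eligible (insert a s) (index a s).+1 &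
      forall j, j <= index a s -> ~~ eligible (insert a s) j].
Proof.
move=> ds am nel; have [x [y [es ax ix]]] := split_first (dyck_to_mem ds (ltnW am)).
have si : (index a s).+2 < size (insert a s).
  rewrite es in ds *; rewrite insert_first // index_cat (negbTE ax) /= eqxx addn0.
  rewrite size_cat /=; case/and3P: ds => _ _; case: (y) => [|c v]; last first.
    by rewrite /= !addnS !ltnS leq_addr.
  by rewrite last_cat /= => /eqP e; move: am; rewrite e ltnn.
have nthi : nth 0 (insert a s) (index a s).+1 = a.+1.
  by rewrite ix es insert_first // nth_cat ltnNge leqnSn /= subSnn.
have nthi0 : nth 0 (insert a s) (index a s) = a.
  by rewrite ix es insert_first // nth_cat ltnn subnn.
split=> //.
- rewrite eligibleE (ltn_trans (ltnSn _) si) nthi si /=; apply/andP; split.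
    rewrite es insert_first // -es ix -cat_rcons -(size_rcons x a) take_size_cat //.
    rewrite -cats1 count_cat /= eqxx addn0 (eq_count (a2 := pred1 a)) //.
    by have /count_memPn -> := ax.
  have -> : nth 0 (insert a s) (index a s).+2 = head 0 y.
    by rewrite ix es insert_first // nth_cat -(addn2 (size x)) ltnNge leq_addr addKn /= nth0.
  by case/and3P: ds => /and3P[_ _]; rewrite es => /dyck_step.
- move=> j; rewrite leq_eqVlt => /predU1P[->|ji].
    by rewrite eligibleE nthi0 nthi (ltnW si) ltnn /= !andbF.
  rewrite (@eq_eligible _ s (index a s)) ?nel //.
  - rewrite es insert_first // index_cat (negbTE ax) /= eqxx addn0 -(size_rcons x a).
    by rewrite -[x ++ a :: y]cat_rcons -[x ++ a :: _ :: y]cat_rcons !take_size_cat.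
  - by rewrite (ltn_trans _ si) // ltnW.
  - by rewrite ix es size_cat /= addnS ltnS leq_addr.
Qed.

(** As [k] meets the counting condition, it fails to be eligible only if the next letter is larger,
    hence larger by exactly 1. That letter is again a first occurrence with a single letter one
    below it to its left, so the run goes on. *)
Lemma no_eligible_run s k j : is_dyck s -> j < size s -> k <= j ->
  nth 0 s k \notin take k s ->
  count (fun b => b.+1 == nth 0 s k) (take k s) = 1 ->
  (forall i, i < j -> ~~ eligible s i) -> nth 0 s j = nth 0 s k + (j - k).
Proof.
move=> ds js kj; have [n le] := ubnP (j - k); elim: n k kj le => // n IH k kj le nk ck nel.
move: kj; rewrite leq_eqVlt => /predU1P[->|kj]; first by rewrite subnn addn0.
have kS : k.+1 < size s by exact: leq_ltn_trans js.
have ks : k < size s by exact: ltnW.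
have := nel k kj; rewrite eligibleE ks ck eqxx kS /= -ltnNge => lt1.
have e1 : nth 0 s k.+1 = (nth 0 s k).+1.
  apply/eqP; rewrite eqn_leq lt1 andbT; case/and3P: ds => _ _ /(sortedP 0) st; exact: st.
have tk : take k.+1 s = rcons (take k s) (nth 0 s k) by rewrite (take_nth 0).
have lt : all (fun b => b < nth 0 s k) (take k s).
  by apply: (@dyck_prefix_lt _ _ (drop k.+1 s)) => //; rewrite -drop_nth // cat_take_drop.
rewrite (IH k.+1) // ?e1 ?tk.
- by rewrite addSn -addnS -subSn // subSS.
- by rewrite subnS prednK ?subn_gt0.
- rewrite mem_rcons inE negb_or gtn_eqF //=.
  by apply/negP => /(allP lt); rewrite ltnNge leqnSn.
- rewrite -cats1 count_cat /= eqxx addn0 (eq_count (a2 := pred1 (nth 0 s k))) //.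
  by have /count_memPn -> := nk.
Qed.

Lemma first_eligible m s j : dyck_to m s -> j.+1 < size s -> eligible s j ->
  (forall i, i < j -> ~~ eligible s i) ->
  exists a s', [/\ s = insert a s', dyck_to m s', a < m &
     forall i, i < index a s' -> ~~ eligible s' i].
Proof.
move=> ds jS elj nel; have js := ltnW jS.
have dys : is_dyck s by case/and3P: ds.
move: elj; rewrite eligibleE js jS /= => /andP[c1 nx].
set c := nth 0 s j in c1 nx; set z := take j s in c1.
have es : s = z ++ c :: drop j.+1 s by rewrite /c -drop_nth // cat_take_drop.
have sz : size z = j by rewrite /z size_take js.
(* Otherwise the first [c] starts a strictly ascending run reaching position [j], where the letter
   is [c] again. *)
have cz : c \notin z.
  apply/negP => cz; have kj : index c s < j by exact: index_ltn.
  have cs : c \in s by rewrite es mem_cat cz.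
  have nk : nth 0 s (index c s) = c by exact: nth_index.
  have := @no_eligible_run s (index c s) j dys js (ltnW kj); rewrite nk.
  rewrite in_take // ltnn => /(_ isT) run.
  (* At most one, since this prefix lies inside [z]; at least one, since the letter one below [c]
     precedes the first [c]. *)
  have /run/(_ nel) : count (fun b => b.+1 == c) (take (index c s) s) = 1.
    apply/eqP; rewrite eqn_leq -{1}(eqP c1) /z; apply/andP; split.
      by rewrite -[take j s](cat_take_drop (index c s)) count_cat take_takel ?leq_addr // ltnW.
    rewrite -has_count; have : 0 < count (fun b => b.+1 == c) z by rewrite (eqP c1).
    rewrite -has_count => /hasP[b bz /eqP eb].
    apply/hasP; exists b; last by rewrite eb.
    have bs : b \in s by rewrite es mem_cat bz.
    rewrite in_take // ltn_neqAle dyck_index_leq //; last by rewrite -eb.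
    rewrite andbT.
    apply/eqP => eib; have := nth_index 0 bs; rewrite eib nk -eb => /eqP.
    by rewrite gtn_eqF.
  by rewrite -/c; move=> /eqP; rewrite -[X in X == _]addn0 eqn_add2l eq_sym subn_eq0 leqNgt kj.
have : has (fun b => b.+1 == c) z by rewrite has_count (eqP c1).
case/hasP => a az /eqP eac.
have [x [x' [ez ax _]]] := split_first az.
have dz : is_dyck z.
  by apply: (@dyck_cat _ (c :: drop j.+1 s)); rewrite -?es //; case: (z) az.
have ax' : a \notin x'.
  move: c1; rewrite ez count_cat /= eac eqxx => c1; apply/negP => ax'.
  have : has (fun b => b.+1 == c) x' by apply/hasP; exists a; rewrite ?eac.
  by rewrite has_count; move: c1; lia.
(* The entry [e] just before [c] satisfies [c <= e.+1] and differs from [a], so [e] is at least [c],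
   and [c] would already occur in [z]. *)
have x'0 : x' = [::].
  case/lastP: x' => [//|x' e] in ez ax' *.
  have ez' : e \in z by rewrite ez mem_cat inE mem_rcons inE eqxx !orbT.
  have ce : c <= e.+1.
    have es2 : s = (x ++ a :: x') ++ e :: c :: drop j.+1 s.
      by rewrite -cat_rcons rcons_cat rcons_cons -ez.
    by case/and3P: dys => _ _; rewrite es2 => /dyck_step.
  have ne : a != e by apply: contra ax' => /eqP ->; rewrite mem_rcons inE eqxx.
  by move: cz; rewrite (dyck_ivt dz ez') //; lia.
subst x'; set y := drop j.+1 s in es.
have es' : s = x ++ a :: a.+1 :: y by rewrite es ez -catA /= eac.
have hy : head 0 y <= a.+1 by rewrite /y -nth0 nth_drop addn0 eac.
have y0 : y <> [::] by move=> e0; move: jS; rewrite es e0 size_cat sz addn1 ltnn.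
case/and3P: ds => _ mx lm.
exists a, (x ++ a :: y); split.
- by rewrite insert_first.
- apply/and3P; split.
  + apply/and3P; split; first by case: (x).
      by case/and3P: dys => _; rewrite es'; case: (x).
    have py : path [rel a b | b <= a.+1] a.+1 y -> path [rel a b | b <= a.+1] a y.
      by case: (y) hy => //= d w -> /andP[_ ->].
    case/and3P: dys => _ _; rewrite es'; case: (x) => [|b v] /=; rewrite ?cat_path /=.
      by move=> /andP[_ /py].
    by move=> /and4P[-> -> _ /py ->].
  + by move: mx; rewrite es' !all_cat /= => /and4P[-> -> _ ->].
  + by move: lm; rewrite es' !last_cat /=; case: (y) y0.
- by move: mx; rewrite es' all_cat /= => /and4P[].
- move=> i; rewrite index_cat (negbTE ax) /= eqxx addn0 => ix.
  rewrite (@eq_eligible _ s (size x)) // ?nel //.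
  + by rewrite -sz ez size_cat (leq_trans ix) ?leq_addr.
  + rewrite es' -(size_rcons x a).
    by rewrite -[x ++ a :: y]cat_rcons -[x ++ a :: _ :: y]cat_rcons !take_size_cat.
  + by rewrite size_cat /= addnS ltnS leq_addr.
  + by rewrite es' size_cat /= addnS ltnS leq_addr.
Qed.

(** * Building sequences from a skeleton and a recorded word *)

(** The head of [u] is inserted last, hence is the first to be extracted. *)
Definition build (u F : seq nat) : seq nat := foldr insert F u.

Definition falls_le1 : rel nat := [rel a b | a <= b.+1].

Lemma index_insert m s a : dyck_to m s -> a < m ->
  index a.+1 (insert a s) = (index a s).+1.
Proof.
move=> ds am; have [x [y [es ax ix]]] := split_first (dyck_to_mem ds (ltnW am)).
have xlt : all (fun b => b < a) x.
  by apply: (@dyck_prefix_lt _ _ y) => //; rewrite -es; case/and3P: ds.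
have aSx : a.+1 \notin x by apply/negP => /(allP xlt); rewrite ltnNge leqnSn.
rewrite ix es insert_first // index_cat (negbTE aSx) /= eqxx.
by rewrite ltn_eqF // addn1.
Qed.

Lemma dyck_to_build m F u : dyck_to m F -> all (fun a => a < m) u -> dyck_to m (build u F).
Proof. by move=> dF; elim: u => //= a u IH /andP[am /IH du]; exact: dyck_to_insert. Qed.

(** Inserting [b] makes the first [b.+1] the first eligible position, and [a <= b.+1] puts the first
    [a] no later than that. For empty [u], the skeleton has no nonfinal eligible index. *)
Lemma build_not_eligible m F a u : is_skeleton m F ->
  all (fun b => b < m) (a :: u) -> sorted falls_le1 (a :: u) ->
  forall j, j < index a (build u F) -> ~~ eligible (build u F) j.
Proof.
move=> /dyck_to_skeleton[dF elF]; elim: u a => [|b u IH] a /= /andP[am um].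
  move=> _ j ji; apply: elF; apply: leq_ltn_trans ji _; rewrite index_mem.
  by apply: dyck_to_mem dF _; exact: ltnW.
case/andP=> ab st j ji; have /andP[bm um'] := um.
have du := dyck_to_build dF um'.
have [_ _ _ nel] := insert_eligible du bm (IH b um st).
apply: nel; rewrite -ltnS -(index_insert du bm).
apply: (leq_trans ji); apply: dyck_index_leq => //.
  by have /and3P[] := dyck_to_insert du bm.
by apply: dyck_to_mem (dyck_to_insert du bm) _.
Qed.

Lemma dyck_to_buildP m s : dyck_to m s ->
  exists u F, [/\ is_skeleton m F, all (fun a => a < m) u, sorted falls_le1 u & s = build u F].
Proof.
have [n le] := ubnP (size s); elim: n s le => // n IH s le ds.
have [/existsP[j0 /andP[jS0 el0]]|nel] :=
    boolP [exists j : 'I_(size s), (j.+1 < size s) && eligible s j]; last first.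
  exists [::], s; split => //; apply/dyck_to_skeleton; split=> // j jS.
  move/existsPn: nel => /(_ (Ordinal (ltnW jS))); by rewrite jS.
have ex : exists j, (j.+1 < size s) && eligible s j by exists (val j0); rewrite jS0.
case: (ex_minnP ex) => j /andP[jS elj] min_j.
have nel i : i < j -> ~~ eligible s i.
  move=> ij; apply/negP => eli; have := min_j i; rewrite eli (ltn_trans _ jS) // => /(_ isT).
  by rewrite leqNgt ij.
have [a [s' [es ds' am nel']]] := first_eligible ds jS elj nel.
have size_s : size s = (size s').+1.
  by rewrite es /insert size_cat /= addnS -size_cat cat_take_drop.
have [|u [F [skF um st es']]] := IH s' _ ds'; first by rewrite -size_s.
exists (a :: u), F; split=> //=; rewrite ?am ?es ?es' //.
case: u um st es' => //= b u /andP[bm um] st es'; rewrite st andbT.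
have dF : dyck_to m F by case/dyck_to_skeleton: skF.
have du := dyck_to_build dF um.
have bum : all (fun c => c < m) (b :: u) by rewrite /= bm.
have [_ _ elb _] := insert_eligible du bm (build_not_eligible skF bum st).
(* If [b.+1 < a], the first [b.+1], which is eligible in [s'], would precede the first [a], against
   [nel']. *)
rewrite /falls_le1 /= leqNgt; apply/negP => ba.
have aS : a \in s' by apply: dyck_to_mem ds' _; exact: ltnW.
have bS : b.+1 \in s' by apply: dyck_to_mem ds' _.
have : index b.+1 s' <= index a s'.
  by apply: dyck_index_leq aS _; [case/and3P: ds' | exact: ltnW].
rewrite leq_eqVlt => /predU1P[e|/nel'].
  by move: ba; rewrite -(nth_index 0 aS) -e nth_index // ltnn.
by rewrite es' /= (index_insert du bm) elb.
Qed.

(** The head of the word is read off from the first eligible position; deleting that entry undoes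
    the last insertion. *)
Lemma build_inj m m' F F' u u' : is_skeleton m F -> is_skeleton m' F' ->
  all (fun a => a < m) u -> sorted falls_le1 u -> all (fun a => a < m') u' -> sorted falls_le1 u' ->
  build u F = build u' F' -> u = u' /\ F = F'.
Proof.
have one k G v b : is_skeleton k G -> all (fun a => a < k) (b :: v) -> sorted falls_le1 (b :: v) ->
    let s := build (b :: v) G in let i := index b (build v G) in
    [/\ i.+2 < size s, eligible s i.+1, forall j, j <= i -> ~~ eligible s j,
      nth 0 s i.+1 = b.+1 & build v G = take i.+1 s ++ drop i.+2 s].
  move=> skG bvm st s i; have := build_not_eligible skG bvm st.
  move: bvm => /= /andP[bk vm]; have dG : dyck_to k G by case/dyck_to_skeleton: skG.
  have dv := dyck_to_build dG vm.
  case/(insert_eligible dv bk) => h1 h2 h3 h4; split=> //.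
  have [x [y [es ax ix]]] := split_first (dyck_to_mem dv (ltnW bk)).
  rewrite /s /= /i ix es insert_first // -(size_rcons x b).
  rewrite -[x ++ b :: y]cat_rcons -[x ++ b :: _ :: y]cat_rcons take_size_cat //.
  by rewrite drop_cat ltnNge leqnSn subSnn /= drop0.
have base k G k' G' v b : is_skeleton k G -> is_skeleton k' G' ->
    all (fun a => a < k') (b :: v) -> sorted falls_le1 (b :: v) -> G <> build (b :: v) G'.
  move=> /dyck_to_skeleton[_ elG] skG' bvm st eG.
  have [h1 h2 _ _ _] := one _ _ _ _ skG' bvm st.
  by have := elG _; rewrite {1}eG => /(_ _ h1); rewrite eG h2.
move=> skF skF'; elim: u u' => [|a u IH] [|a' u'] um st um' st' eb.
- by [].
- by case: (base _ _ _ _ _ _ skF skF' um' st').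
- by case: (base _ _ _ _ _ _ skF' skF um st).
have [h1 h2 h3 h4 h5] := one _ _ _ _ skF um st.
have [k1 k2 k3 k4 k5] := one _ _ _ _ skF' um' st'.
rewrite -eb in k1 k2 k3 k4 k5.
have ei : index a (build u F) = index a' (build u' F').
  case: (ltngtP (index a (build u F)) (index a' (build u' F'))) => // lt.
    by have := k3 _ lt; rewrite h2.
  by have := h3 _ lt; rewrite k2.
have [uu' FF'] : u = u' /\ F = F'.
  apply: IH; [by case/andP: um|exact: path_sorted st|by case/andP: um'|exact: path_sorted st'|].
  by rewrite h5 k5 ei.
by split=> //; congr (_ :: _) => //; move: k4; rewrite -ei h4 => -[].
Qed.

Lemma count_build m F u c : dyck_to m F -> all (fun a => a < m) u ->
  count_mem c (build u F) = count_mem c F + count (fun b => b.+1 == c) u.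
Proof.
move=> dF; elim: u => [|a u IH] /=; first by rewrite addn0.
case/andP=> am um; rewrite /insert count_cat /= addnCA -count_cat cat_take_drop IH //.
by rewrite addnCA.
Qed.

Lemma area_build F u : area (build u F) = area F + area u + size u.
Proof.
rewrite /area; elim: u => [|a u IH] /=; first by rewrite !addn0.
rewrite /insert sumn_cat /= addnCA -sumn_cat cat_take_drop IH; lia.
Qed.

Lemma size_build F u : size (build u F) = size F + size u.
Proof.
elim: u => [|a u IH] /=; first by rewrite addn0.
by rewrite /insert size_cat /= !addnS -size_cat cat_take_drop IH.
Qed.

(** No [a.+1] or larger precedes the inserted [a.+1], so it gains one pair for each [a] and [a.+1]
    in [build u F ++ w], except for the first [a]. By [count_build], the letter [a] placed between
    [w] and [u] gains exactly one pair more. *)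
Lemma dinv_build m F u w : dyck_to m F -> all (fun a => a < m) u ->
  dinv (build u F ++ w) + size u = dinv (F ++ w ++ u).
Proof.
move=> dF; elim: u => [|a u IH] /=; first by rewrite cats0 addn0.
case/andP=> am um; have du := dyck_to_build dF um.
rewrite catA dinv_insert -catA -(IH um).
have [x [y [es ax ix]]] := split_first (dyck_to_mem du (ltnW am)).
have xlt : all (fun b => b < a) x.
  by apply: (@dyck_prefix_lt _ _ y) => //; rewrite -es; case/and3P: du.
have x0 c : a <= c -> count_mem c x = 0.
  by move=> ac; apply/count_memPn/negP => /(allP xlt); rewrite ltnNge ac.
have := count_build a dF um; have := count_build a.+1 dF um.
have -> : insert a (build u F) ++ w = rcons x a ++ a.+1 :: (y ++ w).
  by rewrite es insert_first // cat_rcons -catA.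
have sw : rcons x a ++ y ++ w = build u F ++ w by rewrite es cat_rcons -catA.
rewrite dinv_insert sw es -cats1 !count_cat /= eqxx [a == a.+1]ltn_eqF // [a == a.+2]ltn_eqF //.
rewrite !x0 ?leqW //.
have -> : count (fun b => b.+1 == a.+1) y = count_mem a y by [].
have -> : count (fun b => b.+1 == a.+1) w = count_mem a w by [].
have -> : count (fun b => b.+1 == a.+1) u = count_mem a u by [].
by lia.
Qed.

(** * Column words and two-column tableaux *)

Lemma dyck_to_cat m s w : dyck_to m s -> all (fun a => a < m) w ->
  sorted [rel a b | b <= a.+1] w -> is_dyck (s ++ w).
Proof.
case/and3P=> ds _ /eqP lm wm sw; case: s ds lm => // c s /and3P[_ /= c0 st] lm.
rewrite /is_dyck /= c0 cat_path st lm /=.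
by case: w wm sw => //= a w /andP[am _] ->; rewrite leqW // ltnW.
Qed.

Lemma dyck_split D : is_dyck D ->
  exists m s w, [/\ dyck_to m s, all (fun a => a < m) w,
    sorted [rel a b | b <= a.+1] w & D = s ++ w].
Proof.
move=> dD; pose m := \max_(a <- D) a.
have Dm a : a \in D -> a <= m by exact: leq_bigmax_mem.
(* Reversing turns the last occurrence of [m] into the first, so that [split_first] applies. *)
have mD : m \in rev D.
  rewrite mem_rev /m; case: D dD {Dm m} => // c D _.
  elim: D c => [|d D IH] c; first by rewrite big_seq1 mem_head.
  rewrite big_cons; case: (leqP c (\max_(j <- d :: D) j)) => _; last exact: mem_head.
  by rewrite inE IH orbT.
have [x [y [eD mx _]]] := split_first mD.
have {}eD : D = rcons (rev y) m ++ rev x.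
  by rewrite -[D]revK eD rev_cat rev_cons.
exists m, (rcons (rev y) m), (rev x); split=> //.
- apply/and3P; split; last by rewrite last_rcons.
    by apply: dyck_cat (rev x) _ _; rewrite -?eD //; case: (rev y).
  by apply/allP => a ay; apply: Dm; rewrite eD mem_cat ay.
- apply/allP => a; rewrite mem_rev => ax; rewrite ltn_neqAle Dm ?andbT.
    by apply: contraNneq mx => <-.
  by rewrite eD mem_cat mem_rev ax orbT.
- case/and3P: dD => _ _; rewrite eD; case: (rcons _ _) => //= c z.
  by rewrite cat_path => /andP[_ /path_sorted].
Qed.

Lemma dyck_split_inj m m' s s' w w' : dyck_to m s -> dyck_to m' s' ->
  all (fun a => a < m) w -> all (fun a => a < m') w' -> s ++ w = s' ++ w' ->
  [/\ m = m', s = s' & w = w'].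
Proof.
have le k k' v v' z z' : dyck_to k v -> dyck_to k' v' -> all (fun a => a < k) z ->
    all (fun a => a < k') z' -> v ++ z = v' ++ z' -> k <= k'.
  move=> dv /and3P[_ /allP vk _] _ /allP zk e; have := dyck_to_mem dv (leqnn k).
  move=> kv; have : k \in v' ++ z' by rewrite -e mem_cat kv.
  by rewrite mem_cat => /orP[/vk|/zk /ltnW].
move=> ds ds' wm wm' e.
have em : m = m'.
  by apply/eqP; rewrite eqn_leq (le _ _ _ _ _ _ ds ds' wm wm' e) (le _ _ _ _ _ _ ds' ds wm' wm (esym e)).
subst m'.
(* The last [k] ends [v], so its position from the right is the length of [z], which fixes the
   cut. *)
have cut k v z : dyck_to k v -> all (fun a => a < k) z -> index k (rev (v ++ z)) = size z.
  case/and3P => dv _ /eqP; case/lastP: v dv => // v c _; rewrite last_rcons => -> zk.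
  rewrite rev_cat rev_rcons index_cat mem_rev ifN; last first.
    by apply/negP => /(allP zk); rewrite ltnn.
  by rewrite /= eqxx addn0 size_rev.
have sw : size w = size w' by rewrite -(cut m s) // -(cut m s' w') // e.
have ss : size s = size s'.
  by have := congr1 size e; rewrite !size_cat sw => /eqP; rewrite eqn_add2r => /eqP.
by move/eqP: e; rewrite eqseq_cat // => /andP[/eqP -> /eqP ->].
Qed.

(* The bound [c] stands for a letter to be appended: the last letter [a] of a
   nonempty word satisfies [c <= a.+1].  In [col_tableaux] the bounds [c] and [d]
   are in the same way the entries of a row to be put on top. *)
Fixpoint col_words (m k c : nat) : seq (seq nat) :=
  if k is k'.+1 then
    [seq rcons w a | a <- [seq a <- iota 0 m | (c <= a.+1)%N], w <- col_words m k' a]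
  else [:: [::]].

Fixpoint col_tableaux (m k c d : nat) : seq (seq (seq nat)) :=
  if k is k'.+1 then
    [seq [seq [:: a] | a <- rev w] | w <- col_words m k c] ++
    [seq [:: ef.2; ef.1] :: T |
       ef <- [seq (f, e) | f <- [seq f <- iota 0 m | (d <= f.+1)%N],
                           e <- [seq e <- iota 0 m | (c <= e.+1)%N && (e.+2 <= f)%N]],
       T <- col_tableaux m k' ef.2 ef.1]
  else [:: [::]].

Lemma size_col_words m k c w : w \in col_words m k c -> size w = k.
Proof.
elim: k c w => [|k IH] c w /=; first by rewrite inE => /eqP ->.
by case/allpairsPdep => a [v [_ /IH sv ->]]; rewrite size_rcons sv.
Qed.

Lemma flatten_singles (w : seq nat) : flatten (rev [seq [:: a] | a <- rev w]) = w.
Proof. by rewrite -map_rev revK; elim: w => //= a w ->. Qed.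

Lemma col_tableaux_leq m k c d T :
  T \in col_tableaux m k c d -> (k <= size (flatten (rev T)))%N.
Proof.
elim: k c d T => // k IH c d T; rewrite mem_cat => /orP[/mapP[w /size_col_words <- ->]|].
  by rewrite flatten_singles.
case/allpairsPdep => ef [V [_ /IH le ->]].
by rewrite rev_cons flatten_rcons size_cat /= addn2 ltnS leqW.
Qed.

Lemma mem_col_words m k c w : (w \in col_words m k c) =
  [&& size w == k, all (fun a => a < m) w, sorted [rel a b | b <= a.+1] w &
      (w == [::]) || (c <= (last 0 w).+1)].
Proof.
elim: k c w => [|k IH] c w; first by rewrite inE; case: w.
case/lastP: w => [|w a].
  by apply/negbTE/negP => /allpairsPdep[a [v [_ _]]]; case: v.
rewrite size_rcons eqSS last_rcons all_rcons.
have -> : (rcons w a == [::]) = false by case: w.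
have -> : sorted [rel a b | b <= a.+1] (rcons w a) =
    sorted [rel a b | b <= a.+1] w && ((w == [::]) || (a <= (last 0 w).+1)).
  by case: w => //= b w; rewrite rcons_path.
have <- : [&& c <= a.+1, a < m & w \in col_words m k a] =
  [&& size w == k, (a < m) && all (fun a0 => a0 < m) w,
      sorted [rel a0 b | b <= a0.+1] w && ((w == [::]) || (a <= (last 0 w).+1))
    & false || (c <= a.+1)].
  by rewrite IH; case: (c <= _); case: (a < m); rewrite ?andbF ?andbT.
apply/allpairsPdep/and3P => [[b [v [bm vk /rcons_inj[-> ->]]]]|[ca am wk]].
  by move: bm; rewrite mem_filter mem_iota /= add0n => /andP[-> ->].
by exists a, w; rewrite mem_filter mem_iota /= add0n ca.
Qed.

Lemma uniq_col_words m k c : uniq (col_words m k c).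
Proof.
elim: k c => // k IH c; apply: allpairs_uniq_dep.
- by rewrite filter_uniq // iota_uniq.
- by move=> a _; exact: IH.
- by move=> [a w] [b v] _ _ /= /rcons_inj[-> ->].
Qed.

Definition is_col_tableau (m c d : nat) (T : seq (seq nat)) : bool :=
  [&& is_dyck_tableau T, all (fun R => size R <= 2) T, all (all (fun a => a < m)) T &
      if T is R :: _ then
        (c <= (nth 0 R 0).+1) && ((size R == 2) ==> (d <= (nth 0 R 1).+1))
      else true].

Lemma is_col_tableau2 m c d e f T : is_col_tableau m c d ([:: e; f] :: T) =
  [&& e.+2 <= f, f < m, c <= e.+1, d <= f.+1 & is_col_tableau m e f T].
Proof.
rewrite /is_col_tableau /is_dyck_tableau; case: T => [|R T] /=; first lia.
case: R => [|g [|h R]] /=; rewrite ?inE ?andbF //=.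
  lia.
case: R => [|? ?] /=; last by rewrite !andbF.
lia.
Qed.

Lemma uniq_col_tableaux m k c d : uniq (col_tableaux m k c d).
Proof.
elim: k c d => // k IH c d; rewrite cat_uniq; apply/and3P; split.
- rewrite map_inj_uniq ?uniq_col_words // => u v /inj_map e.
  by apply: (can_inj revK); apply: e => a b [].
- apply/hasPn => T /allpairsPdep[ef [V [_ _ ->]]]; apply/negP => /mapP[w _].
  by case: (rev w).
- apply: allpairs_uniq_dep.
  + apply: allpairs_uniq_dep.
    * by rewrite filter_uniq // iota_uniq.
    * by move=> f _; rewrite filter_uniq // iota_uniq.
    * by move=> [f e] [f' e'] _ _ /= [-> ->].
  + by move=> ef _; exact: IH.
  + by move=> [[f e] T] [[f' e'] T'] _ _ /= [-> -> ->].
Qed.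

(** Below a row with one entry all rows have one entry; the second bound is then reset to 0, which
    constrains nothing. *)
Lemma is_col_tableau1 m c d e T : is_col_tableau m c d ([:: e] :: T) =
  [&& e < m, c <= e.+1, all (fun R => size R == 1) T & is_col_tableau m e 0 T].
Proof.
rewrite /is_col_tableau /is_dyck_tableau; case: T => [|R T] /=; first lia.
have ones : [::] \notin T -> path geq 1 (map size T) = all (fun R => size R == 1) T.
  elim: T => //= S T IH; rewrite inE negb_or; case: S => [|? [|? ?]] //= /IH <-.
case: R => [|g [|h R]] /=; rewrite ?inE ?andbF //=.
case: ([::] \in T) ones => [_|/(_ isT) ->]; first by rewrite !andbF.
by lia.
Qed.

(** A one-column tableau is a column word read from bottom to top, whence the [rev]. *)
Lemma mem_singles m k c T :
  (T \in [seq [seq [:: a] | a <- rev w] | w <- col_words m k c]) =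
  [&& size T == k, all (fun R => size R == 1) T & is_col_tableau m c 0 T].
Proof.
elim: k c T => [|k IH] c T; first by rewrite inE; case: T.
case: T => [|R T].
  by apply/negbTE/negP => /mapP[w /size_col_words]; case/lastP: w => // w a; rewrite rev_rcons.
rewrite eqSS; apply/mapP/and3P => [[w]|].
  case/allpairsPdep=> b [v [bm vk ->]]; rewrite rev_rcons /= => -[-> ->].
  have /esym := IH b [seq [:: a] | a <- rev v].
  rewrite (map_f (fun w : seq nat => [seq [:: a] | a <- rev w]) vk) => /and3P[sT T1 cT].
  rewrite sT T1 is_col_tableau1 T1 cT !andbT.
  by move: bm; rewrite mem_filter mem_iota /= add0n => /andP[-> ->].
case=> sT; case: R => [|e [|? ?]] //= T1; rewrite is_col_tableau1 => /and4P[em ce _ cT].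
have /mapP[w wk eT] : T \in [seq [seq [:: a] | a <- rev w] | w <- col_words m k e].
  by rewrite IH sT T1 cT.
exists (rcons w e); last by rewrite rev_rcons eT.
by apply/allpairsPdep; exists e, w; rewrite mem_filter mem_iota /= add0n ce em.
Qed.

Lemma mem_col_tableaux m k c d T :
  (T \in col_tableaux m k c d) = (size T == k) && is_col_tableau m c d T.
Proof.
elim: k c d T => [|k IH] c d T; first by rewrite inE; case: T.
rewrite mem_cat mem_singles.
case: T => [|R T].
  by apply/negbTE/negP => /allpairsPdep[ef [V [_ _]]].
rewrite /= eqSS; case: R => [|e [|f [|g R]]].
- rewrite /is_col_tableau /is_dyck_tableau /= andbF.
  by apply/negbTE/negP => /allpairsPdep[ef [V [_ _]]].
- rewrite !is_col_tableau1 [X in _ || X](_ : _ = false) ?orbF.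
    by case: (all _ T); rewrite ?andbF ?andbT.
  by apply/negbTE/negP => /allpairsPdep[ef [V [_ _]]].
- rewrite andbF /= is_col_tableau2; apply/allpairsPdep/and5P.
    case=> -[f' e'] [V [/allpairsPdep[f2 [e2 [fm em [-> ->]]]] VT [-> -> ->]]].
    move: fm em VT; rewrite !mem_filter !mem_iota /= !add0n IH.
    by move=> /andP[-> ->] /andP[/andP[-> ->] _] /andP[-> ->].
  case=> sT ef fm ce /andP[df cT].
  exists (f, e), T; split=> //; last by rewrite IH sT.
  apply/allpairsPdep; exists f, e; rewrite !mem_filter !mem_iota /= !add0n df fm ce ef; split => //.
  by rewrite (leq_trans _ fm) // leqW // ltnW.
- rewrite /is_col_tableau /= !andbF.
  by apply/negbTE/negP => /allpairsPdep[ef [V [_ _]]].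
Qed.

(** * Duplicate-free lists of the summation indices *)

Definition all_col_words (n m : nat) : seq (seq nat) :=
  flatten [seq col_words m k 0 | k <- iota 0 n.+1].

(** The bounds 0 and 1 constrain nothing; they are distinct because [tab_sumE] requires [c < d]. *)
Definition all_col_tableaux (n m : nat) : seq (seq (seq nat)) :=
  flatten [seq col_tableaux m k 0 1 | k <- iota 0 n.+1].

Lemma uniq_flatten_graded (T : eqType) (L : nat -> seq T) (f : T -> nat) r :
  uniq r -> (forall k, uniq (L k)) -> (forall k x, x \in L k -> f x = k) ->
  uniq (flatten [seq L k | k <- r]).
Proof.
move=> ur uL fL; elim: r ur => //= k r IH /andP[kr /IH ur]; rewrite cat_uniq uL ur andbT.
apply/hasPn => x /flatten_mapP[j jr xj]; apply: contra kr => xk.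
by rewrite -(fL _ _ xk) (fL _ _ xj).
Qed.

Lemma uniq_all_col_words n m : uniq (all_col_words n m).
Proof.
apply: (@uniq_flatten_graded _ _ size); first exact: iota_uniq.
- by move=> k; exact: uniq_col_words.
- by move=> k x /size_col_words.
Qed.

Lemma uniq_all_col_tableaux n m : uniq (all_col_tableaux n m).
Proof.
apply: (@uniq_flatten_graded _ _ size); first exact: iota_uniq.
- by move=> k; exact: uniq_col_tableaux.
- by move=> k x; rewrite mem_col_tableaux => /andP[/eqP].
Qed.

Lemma mem_all_col_words n m w : (w \in all_col_words n m) =
  [&& size w <= n, all (fun a => a < m) w & sorted [rel a b | b <= a.+1] w].
Proof.
apply/flatten_mapP/idP => [[k]|/and3P[wn wm sw]].
  rewrite mem_iota /= add0n ltnS mem_col_words => kn /and4P[/eqP -> -> -> _].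
  by rewrite kn.
by exists (size w); rewrite ?mem_iota ?mem_col_words ?eqxx ?wm ?sw ?orbT.
Qed.

Lemma mem_all_col_tableaux n m T : (T \in all_col_tableaux n m) =
  [&& size T <= n, is_dyck_tableau T, all (fun R => size R <= 2) T & all (all (fun a => a < m)) T].
Proof.
have trivial_head : is_col_tableau m 0 1 T =
    [&& is_dyck_tableau T, all (fun R => size R <= 2) T & all (all (fun a => a < m)) T].
  by rewrite /is_col_tableau; case: T => [|R T]; rewrite /= ?implybT ?andbT.
apply/flatten_mapP/idP => [[k]|/andP[Tn cT]].
  by rewrite mem_iota /= add0n ltnS mem_col_tableaux trivial_head => kn /andP[/eqP -> ->]; rewrite kn.
by exists (size T); rewrite ?mem_iota // mem_col_tableaux eqxx trivial_head.
Qed.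

Lemma size_leq_RR m T : is_dyck_tableau T -> all (fun R => size R <= 2) T ->
  all (all (fun a => a < m)) T -> size T <= size (RR T).
Proof.
move=> h1 h2 h3; apply: (@col_tableaux_leq m _ 0 0); rewrite mem_col_tableaux eqxx.
by rewrite /is_col_tableau h1 h2 h3; case: (T) => //= R V; rewrite implybT.
Qed.

(** Letters of a Dyck sequence are smaller than its length, so [all_col_words n n] contains every
    candidate; the last letter recovers [m]. *)
Definition skeletons (n : nat) : seq (seq nat) :=
  [seq F <- all_col_words n n | `[< is_skeleton (last 0 F) F >]].

Lemma mem_skeletons n F : (F \in skeletons n) <-> size F <= n /\ is_skeleton (last 0 F) F.
Proof.
rewrite mem_filter mem_all_col_words; split=> [/andP[/asboolP skF /and3P[Fn _ _]] //|[Fn skF]].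
have dF : is_dyck F by case: skF.
rewrite Fn asboolT //=; apply/andP; split; last by case/and3P: dF.
by apply/allP => a aF; exact: leq_trans (dyck_ltn dF aF) Fn.
Qed.

Lemma is_skeleton_last m F : is_skeleton m F -> last 0 F = m.
Proof. by case. Qed.

(** The recorded word is stored reversed, which makes it a column word: [w] and [u] range over the
    same list. *)
Definition dyck_data (n : nat) : seq (seq nat * (seq nat * seq nat)) :=
  [seq (F, wu) | F <- skeletons n,
     wu <- [seq wu <- [seq (w, u) | w <- all_col_words n (last 0 F), u <- all_col_words n (last 0 F)]
             | size F + size (wu.1 ++ rev wu.2) == n]].

Definition dyck_of_data (d : seq nat * (seq nat * seq nat)) : seq nat :=
  build (rev d.2.2) d.1 ++ d.2.1.

Lemma mem_dyck_data n F w u : (F, (w, u)) \in dyck_data n <->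
  [/\ F \in skeletons n, w \in all_col_words n (last 0 F), u \in all_col_words n (last 0 F) &
      size F + size (w ++ rev u) = n].
Proof.
split=> [/allpairsPdep[F' [[w' u'] [FS wuL [-> -> ->]]]]|[FS wW uW sn]].
  move: wuL; rewrite mem_filter => /andP[/eqP sn /allpairsPdep[w1 [u1 [wW uW [ew eu]]]]].
  by rewrite ew eu; split => //; rewrite -ew -eu.
apply/allpairsPdep; exists F, (w, u); split=> //; rewrite mem_filter sn eqxx.
by apply/allpairsPdep; exists w, u.
Qed.

Lemma uniq_dyck_data n : uniq (dyck_data n).
Proof.
apply: allpairs_uniq_dep.
- by rewrite filter_uniq // uniq_all_col_words.
- move=> F _; rewrite filter_uniq //; apply: allpairs_uniq; rewrite ?uniq_all_col_words //.
  by move=> [w u] [w' u'] _ _ /= [-> ->].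
- by move=> [F wu] [F' wu'] _ _ /= [-> ->].
Qed.

Lemma falls_le1_rev u : sorted falls_le1 (rev u) = sorted [rel a b | b <= a.+1] u.
Proof. exact: rev_sorted. Qed.

Lemma dyck_of_data_inj n : {in dyck_data n &, injective dyck_of_data}.
Proof.
move=> [F [w u]] [F' [w' u']] /mem_dyck_data[/mem_skeletons[_ skF] wW uW _].
move=> /mem_dyck_data[/mem_skeletons[_ skF'] wW' uW' _].
move: wW uW wW' uW'; rewrite !mem_all_col_words => /and3P[_ wm _] /and3P[_ um su].
move=> /and3P[_ wm' _] /and3P[_ um' su']; rewrite /dyck_of_data /= => e.
rewrite -all_rev in um; rewrite -all_rev in um'.
rewrite -falls_le1_rev in su; rewrite -falls_le1_rev in su'.
have dF : dyck_to (last 0 F) F by case/dyck_to_skeleton: skF.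
have dF' : dyck_to (last 0 F') F' by case/dyck_to_skeleton: skF'.
have [em es ->] := dyck_split_inj (dyck_to_build dF um) (dyck_to_build dF' um') wm wm' e.
by have [/(can_inj revK) -> ->] := build_inj skF skF' um su um' su' es.
Qed.

Lemma dyck_of_dataP n D : (is_dyck D /\ size D = n) <->
  exists2 d, d \in dyck_data n & D = dyck_of_data d.
Proof.
split=> [[dD sD]|[[F [w u]]]].
  have [m [s [w [ds wm sw eD]]]] := dyck_split dD.
  have [u [F [skF um su es]]] := dyck_to_buildP ds.
  have lF := is_skeleton_last skF.
  have sizes : size F + size w + size u = n.
    by rewrite -sD eD es size_cat size_build addnAC.
  exists (F, (w, rev u)); last by rewrite /dyck_of_data /= revK -es.
  apply/mem_dyck_data; rewrite lF !mem_all_col_words size_rev all_rev revK wm sw um.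
  rewrite -falls_le1_rev revK su size_cat addnA sizes !andbT; split=> //.
  - by apply/mem_skeletons; rewrite lF -sizes -addnA leq_addr.
  - by rewrite -sizes addnAC leq_addl.
  - by rewrite -sizes leq_addl.
move=> /mem_dyck_data[/mem_skeletons[_ skF] wW uW sn] ->; rewrite /dyck_of_data /=.
move: wW uW; rewrite !mem_all_col_words => /and3P[_ wm sw] /and3P[_ um _].
split; last by rewrite size_cat size_build -sn size_cat addnAC addnA.
apply: (dyck_to_cat _ wm sw); apply: dyck_to_build; last by rewrite all_rev.
by case/dyck_to_skeleton: skF.
Qed.

Definition skeleton_pair_list (n : nat) : seq (seq nat * seq (seq nat)) :=
  [seq (F, T) | F <- skeletons n,
     T <- [seq T <- all_col_tableaux n (last 0 F) | size F + size (RR T) == n]].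

Lemma uniq_skeleton_pair_list n : uniq (skeleton_pair_list n).
Proof.
apply: allpairs_uniq_dep.
- by rewrite filter_uniq // uniq_all_col_words.
- by move=> F _; rewrite filter_uniq // uniq_all_col_tableaux.
- by move=> [F T] [F' T'] _ _ /= [-> ->].
Qed.

Lemma skeleton_pairsE n FT : skeleton_pairs n FT <-> FT \in skeleton_pair_list n.
Proof.
split=> [[m [skF dT T2 Tm sn]]|/allpairsPdep[F [T [/mem_skeletons[Fn skF] TL ->]]]].
  have lF := is_skeleton_last skF.
  apply/allpairsPdep; exists FT.1, FT.2; split; last by case: FT {skF dT T2 Tm sn lF}.
    by apply/mem_skeletons; rewrite lF -sn leq_addr.
  rewrite mem_filter sn eqxx mem_all_col_tableaux lF dT T2 Tm !andbT /=.
  by rewrite (leq_trans (size_leq_RR dT T2 Tm)) // -sn leq_addl.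
move: TL; rewrite mem_filter mem_all_col_tableaux => /andP[/eqP sn /and4P[_ dT T2 Tm]].
by exists (last 0 F).
Qed.

(** * Semistandard tableaux with at most two rows *)

Lemma sorted_bits (R : seq nat) : sorted leq R -> all (fun a => a < 2) R ->
  R = nseq (count_mem 0 R) 0 ++ nseq (count_mem 1 R) 1.
Proof.
elim: R => //= a R IH; rewrite path_sortedE; last exact: leq_trans.
case/andP=> aR /IH{}IH /andP[a2 /IH eR].
case: a a2 aR => [|[|//]] _ aR /=; first by rewrite -eR.
have R0 : count_mem 0 R = 0 by apply/count_memPn/negP => /(allP aR).
by rewrite R0 /= [in LHS]eR R0.
Qed.

Lemma sorted_nseq_bits i j : sorted leq (nseq i 0 ++ nseq j 1).
Proof.
elim: i => [|i IH] /=; first by case: j => //= j; elim: j => //= j.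
by rewrite path_sortedE ?IH ?andbT; [apply/allP|exact: leq_trans].
Qed.

Definition bit_row (a i : nat) : seq nat := nseq i 0 ++ nseq (a - i) 1.

Lemma bit_rowP (a : nat) (R : seq nat) :
  size R = a -> all (fun c => c < 2) R -> sorted leq R ->
  R = bit_row a (count_mem 0 R) /\ count_mem 0 R <= a.
Proof.
move=> sR R2 stR; have eR := sorted_bits stR R2; split; last by rewrite -sR count_size.
have := congr1 size eR; rewrite size_cat !size_nseq sR /bit_row => ->.
by rewrite addKn -eR.
Qed.

Lemma bit_row_wf a i : i <= a -> [&& size (bit_row a i) == a,
  all (fun c => c < 2) (bit_row a i) & sorted leq (bit_row a i)].
Proof.
move=> ia; rewrite sorted_nseq_bits size_cat !size_nseq subnKC // eqxx all_cat !all_nseq.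
by rewrite !orbT.
Qed.

Lemma count_bit_row a i : i <= a ->
  (count_mem 0 (bit_row a i) = i) * (count_mem 1 (bit_row a i) = a - i).
Proof. by move=> ia; rewrite !count_cat !count_nseq /= !mul1n !mul0n addn0. Qed.

Lemma is_ssyt1 a T : is_ssyt 2 [:: a] T <-> exists2 i, i <= a & T = [:: bit_row a i].
Proof.
split=> [|[i ia ->]]; last first.
  by have /and3P[sz b st] := bit_row_wf ia; rewrite /is_ssyt /= (eqP sz) eqxx b st.
case/and4P=> /eqP; case: T => [|R [|? ?]] //= [sR] /andP[R2 _] /andP[stR _] _.
by have [eR le] := bit_rowP sR R2 stR; exists (count_mem 0 R); rewrite // -eR.
Qed.

(** Strict columns force the second row to consist of 1s and the entries above it to be 0s. *)
Lemma is_ssyt2 a b T : b <= a ->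
  is_ssyt 2 [:: a; b] T <->
  exists2 i, b <= i <= a & T = [:: bit_row a i; nseq b 1].
Proof.
move=> ba; split=> [|[i /andP[bi ia] ->]]; last first.
  have /and3P[sz c st] := bit_row_wf ia; rewrite /is_ssyt /= (eqP sz) size_nseq eqxx c st.
  rewrite all_nseq orbT (sorted_nseq_bits 0 b) !andbT /=; apply/(all_nthP (0, 0)) => j.
  have sz' : size (zip (bit_row a i) (nseq b 1)) = b.
    by rewrite size_zip (eqP sz) size_nseq; apply/minn_idPr.
  rewrite sz' => jb; rewrite nth_zip_cond sz' jb /= nth_nseq jb nth_cat size_nseq.
  by rewrite (leq_trans jb bi) nth_nseq (leq_trans jb bi).
case/and4P=> /eqP; case: T => [|R [|S [|? ?]]] //= [sR sS] /and3P[R2 S2 _] /and3P[stR stS _].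
rewrite andbT => RS; have [eR le] := bit_rowP sR R2 stR.
have RS1 j : j < b -> nth 0 R j < nth 0 S j.
  have sz : size (zip R S) = b by rewrite size_zip sR sS; apply/minn_idPr.
  move=> jb; have /(_ j) := (all_nthP (0, 0) RS); rewrite sz => /(_ jb).
  by rewrite nth_zip_cond sz jb.
have S1 : S = nseq b 1.
  apply: (@eq_from_nth _ 0); rewrite ?size_nseq // sS => j jb; rewrite nth_nseq jb.
  have : nth 0 S j < 2 by apply: (allP S2); rewrite mem_nth ?sS.
  by have := RS1 j jb; lia.
exists (count_mem 0 R); last by rewrite S1 -eR.
rewrite le andbT leqNgt; apply/negP => c0; have := RS1 _ c0.
rewrite S1 nth_nseq c0 {1}eR nth_cat size_nseq ltnn subnn nth_nseq.
by rewrite subn_gt0 (leq_trans c0 ba).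
Qed.

Lemma conj_two_columns (T : seq (seq nat)) : [::] \notin T -> all (fun R => size R <= 2) T ->
  sorted geq (map size T) ->
  let b := count (fun R => size R == 2) T in
  conj_partition (shape_of T) =
    if T is [::] then [::] else if b == 0 then [:: size T] else [:: size T; b].
Proof.
move=> T0 T2 st b; rewrite /conj_partition /shape_of.
have c0 : count (fun r => 0 < r) (map size T) = size T.
  rewrite count_map; apply/eqP; rewrite -all_count; apply/allP => R RT /=.
  by rewrite lt0n size_eq0; apply: contraNneq T0 => <-.
have c1 : count (fun r => 1 < r) (map size T) = b.
  rewrite count_map; apply: eq_in_count => R /(allP T2) /=; lia.
case: T T0 T2 st @b c0 c1 => // R T; rewrite inE negb_or => /andP[R0 T0] /andP[R2 T2] st b c0 c1.
have [sR|sR] : size R = 1 \/ size R = 2 by case: R R0 R2 {b c0 c1 st} => [|? [|? [|]]] // _ _; [left|right].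
  have b0 : b = 0.
    apply/eqP; rewrite /b -leqn0 leqNgt -has_count; apply/negP => /hasP[S ST /eqP S2].
    move: st; rewrite /= path_sortedE; last by move=> x y z /= h1 h2; exact: leq_trans h2 h1.
    case/andP=> /allP/(_ (size S)) h _; move: ST; rewrite inE => /predU1P[e|ST].
      by move: S2; rewrite e sR.
    by move: (h (map_f size ST)); rewrite S2 /= sR.
  by rewrite b0 [head _ _]/= sR -[RHS]/[:: size (R :: T)] -c0.
have b1 : b == 0 = false by rewrite /b /= sR.
by rewrite b1 [head _ _]/= sR -[RHS]/[:: size (R :: T); b] -c0 -c1.
Qed.

Local Open Scope ring_scope.

(** * Noncommutative Cauchy identity *)

Lemma subr_add4 (V : zmodType) (a b c d : V) : (a - b) + ((c - a) + (b - d)) = c - d.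
Proof. by rewrite addrCA subrKA addrA subrK. Qed.

Section QuantumAlgebra.
Variables (K : comNzRingType) (A : algType K) (X : nat -> A) (t : K).
Hypothesis Xfar : forall a b, (a.+2 <= b)%N -> X a * X b = X b * X a.
Hypothesis Xnear : forall a, X a.+1 * X a = t *: (X a * X a.+1).

(* The shift in the index (letters [a] with [a.+1 < k]) makes [chain_sum (- z) c]
   correspond to the bound [c] of [col_words]; see [col_seriesE]. *)
Fixpoint chain_sum (z : K) (k : nat) : A :=
  if k is k1.+1 then
    if k1 is k2.+1 then chain_sum z k1 + z *: (chain_sum z k2 * X k2) else 1
  else 1.

Lemma chain_sum0 z : chain_sum z 0 = 1. Proof. by []. Qed.
Lemma chain_sum1 z : chain_sum z 1 = 1. Proof. by []. Qed.
Lemma chain_sumSS z k : chain_sum z k.+2 = chain_sum z k.+1 + z *: (chain_sum z k * X k).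
Proof. by []. Qed.
Opaque chain_sum.

(** Only letters at most [k - 2] occur in [chain_sum z k], so all of them are far from [a]. *)
Lemma chain_sum_X z k a : (k <= a)%N -> chain_sum z k * X a = X a * chain_sum z k.
Proof.
have [n le] := ubnP k; elim: n k le => // n IH [|[|k]] le ka;
  rewrite ?chain_sum0 ?chain_sum1 ?mul1r ?mulr1 //.
rewrite chain_sumSS mulrDl mulrDr IH ?(ltnW ka) // -scalerAl -scalerAr -mulrA.
by rewrite (Xfar ka) mulrA IH ?(leq_trans _ ka) ?mulrA // ?leqW // ltnW.
Qed.

(** The terms of [chain_sum z k.+1] outside [chain_sum z k] end in the letter just below [k]; moving
    [X k] past it costs a factor [t]. *)
Lemma X_chain_sum z k : X k * chain_sum z k.+1 = ((1 - t) *: chain_sum z k + t *: chain_sum z k.+1) * X k.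
Proof.
case: k => [|k]; first by rewrite chain_sum0 chain_sum1 mulr1 -scalerDl subrK scale1r mul1r.
rewrite chain_sumSS mulrDr -chain_sum_X // -scalerAr mulrA -chain_sum_X // -mulrA Xnear.
rewrite -scalerAr scalerA [t *: _]scalerDr addrA -scalerDl subrK scale1r.
by rewrite mulrDl scalerA -scalerAl -mulrA mulrC.
Qed.

(** An equality of booleans, because [chain_sum_comm] uses it in both directions. *)
Lemma comm_perturb (a b u v : A) : a * b = b * a -> u * v = v * u ->
  ((a + u) * (b + v) == (b + v) * (a + u)) = (a * v + u * b == v * a + b * u).
Proof.
move=> ab uv; rewrite !mulrDl !mulrDr ab uv -!addrA (inj_eq (addrI _)) !addrA.
by rewrite (inj_eq (addIr _)) [X in _ = (_ == X)]addrC.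
Qed.

Lemma comm_scale_mul x y k : chain_sum x k * chain_sum y k = chain_sum y k * chain_sum x k ->
  (x *: (chain_sum x k * X k)) * (y *: (chain_sum y k * X k)) =
  (y *: (chain_sum y k * X k)) * (x *: (chain_sum x k * X k)).
Proof.
move=> Q; rewrite -!scalerAl -!scalerAr !scalerA mulrC; congr (_ *: _).
by rewrite -!mulrA [X k * (_ * _)]mulrA [X k * (_ * _)]mulrA -!chain_sum_X // -!mulrA !mulrA Q.
Qed.

(** By strong induction only the cross terms of the recurrence remain. Moving the top letter to the
    right and cancelling it reduces them to the cross terms one index lower, which are known from
    the commutation there. *)
Lemma chain_sum_comm x y k : chain_sum x k * chain_sum y k = chain_sum y k * chain_sum x k.
Proof.
have [n le] := ubnP k; elim: n k le x y => // n IH [|[|k]] le x y; rewrite ?chain_sum0 ?chain_sum1 //.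
have {}IH l : (l <= k.+1)%N -> chain_sum x l * chain_sum y l = chain_sum y l * chain_sum x l.
  by move=> lk; apply: IH; apply: (@leq_trans k.+2).
have Q1 := IH _ (leqnn _); have Q0 := IH _ (leqnSn _).
rewrite (chain_sumSS x k) (chain_sumSS y k); apply/eqP.
rewrite comm_perturb; first last.
- exact: comm_scale_mul.
- exact: Q1.
case: k le IH Q1 Q0 => [|j] le IH Q1 Q0.
  by rewrite !chain_sum0 !chain_sum1 !mul1r !mulr1 addrC.
(* These are the cross terms in the commutation [Q0], extracted by [comm_perturb]. *)
have S : chain_sum x j * chain_sum y j.+1 + chain_sum x j.+1 * chain_sum y j =
         chain_sum y j * chain_sum x j.+1 + chain_sum y j.+1 * chain_sum x j.
  case: j le IH Q1 Q0 => [|i] le IH Q1 Q0; first by rewrite !chain_sum0 !chain_sum1.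
  have Qi : chain_sum x i.+1 * chain_sum y i.+1 = chain_sum y i.+1 * chain_sum x i.+1.
    by apply: IH; rewrite ltnW.
  have := Q0; rewrite (chain_sumSS x i) (chain_sumSS y i) => /eqP.
  rewrite comm_perturb; first last.
  - by apply: comm_scale_mul; apply: IH; rewrite !leqW.
  - exact: Qi.
  move=> /eqP S; rewrite !mulrDr !mulrDl Qi.
  by rewrite -!addrA; congr (_ + _); rewrite addrCA S [in RHS]addrCA; congr (_ + _); rewrite addrC.
(* Moving [X j] to the right turns each side into [t] times a side of [S] plus [1 - t] times a
   product of commuting sums, all times [X j]. *)
have R : chain_sum x j * X j * chain_sum y j.+1 + t *: (chain_sum x j.+1 * (chain_sum y j * X j)) =
         chain_sum y j * X j * chain_sum x j.+1 + t *: (chain_sum y j.+1 * (chain_sum x j * X j)).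
  rewrite -!mulrA !X_chain_sum !mulrA !mulrDr -!scalerAr !mulrDl -!scalerAl -!addrA -!scalerDr -!mulrDl.
  by rewrite S (IH j) // !leqW.
apply/eqP.
have XchainE z : X j.+1 * chain_sum z j.+2 = (chain_sum z j.+1 + (t * z) *: (chain_sum z j * X j)) * X j.+1.
  by rewrite X_chain_sum chain_sumSS [t *: _]scalerDr addrA -scalerDl subrK scale1r scalerA.
rewrite -!scalerAl -!scalerAr -!mulrA !XchainE !mulrA !scalerAl -!mulrDl; congr (_ * _).
rewrite (chain_sumSS x j) (chain_sumSS y j) -!scalerAl; move: R.
set p := chain_sum x j.+1 in Q0 *; set r := chain_sum y j.+1 in Q0 *.
set f := chain_sum x j * X j; set g := chain_sum y j * X j => R.
have expand c d (a b u v : A) :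
    c *: ((a + d *: u) * b) + d *: (a * (b + (t * c) *: v)) =
    (c *: (a * b) + d *: (a * b)) + (c * d) *: (u * b + t *: (a * v)).
  rewrite mulrDl mulrDr !scalerDr -scalerAl -scalerAr !scalerA addrACA.
  by have -> : d * (t * c) = c * d * t by rewrite mulrCA mulrC [d * c]mulrC.
rewrite expand [RHS]addrC expand R Q0 [y * x]mulrC.
by rewrite [x *: (r * p) + _]addrC.
Qed.

(** * Series of column words and of two-column tableaux *)

Variables (N m : nat).
Definition word_prod w := \prod_(a <- w) X a.
Hypothesis word_prod_nil : forall w, (N < size w)%N -> word_prod w = 0.

Lemma word_prod_cat u w : word_prod (u ++ w) = word_prod u * word_prod w.
Proof. exact: big_cat. Qed.

Lemma word_prod_cons a w : word_prod (a :: w) = X a * word_prod w.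
Proof. exact: big_cons. Qed.

Lemma word_prod_rcons a w : word_prod (rcons w a) = word_prod w * X a.
Proof. by rewrite -cats1 word_prod_cat word_prod_cons [word_prod [::]]big_nil mulr1. Qed.

Definition col_sum c k := \sum_(w <- col_words m k c) word_prod w.
Definition rev_col_sum c k := \sum_(w <- col_words m k c) word_prod (rev w).

Lemma col_sumS c k : col_sum c k.+1 = \sum_(0 <= a < m | (c <= a.+1)%N) col_sum a k * X a.
Proof.
rewrite /col_sum /= big_allpairs_dep big_filter /index_iota subn0.
apply: eq_bigr => a _; rewrite mulr_suml; apply: eq_bigr => w _; exact: word_prod_rcons.
Qed.

Lemma rev_col_sumS c k : rev_col_sum c k.+1 = \sum_(0 <= a < m | (c <= a.+1)%N) X a * rev_col_sum a k.
Proof.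
rewrite /rev_col_sum /= big_allpairs_dep big_filter /index_iota subn0.
apply: eq_bigr => a _; rewrite mulr_sumr; apply: eq_bigr => w _.
by rewrite rev_rcons word_prod_cons.
Qed.

Lemma col_sum_nil c k : (N < k)%N -> col_sum c k = 0.
Proof.
move=> Nk; rewrite /col_sum big_seq big1 // => w /size_col_words sw.
by rewrite word_prod_nil // sw.
Qed.

Lemma rev_col_sum_nil c k : (N < k)%N -> rev_col_sum c k = 0.
Proof.
move=> Nk; rewrite /rev_col_sum big_seq big1 // => w /size_col_words sw.
by rewrite word_prod_nil // size_rev sw.
Qed.

(** Truncating at [N] loses nothing, since longer words vanish by [word_prod_nil]. *)
Definition col_series z c := \sum_(0 <= k < N.+1) z ^+ k *: col_sum c k.
Definition rev_col_series z c := \sum_(0 <= k < N.+1) z ^+ k *: rev_col_sum c k.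

Lemma col_series_rec z c :
  col_series z c = 1 + \sum_(0 <= a < m | (c <= a.+1)%N) z *: (col_series z a * X a).
Proof.
rewrite /col_series big_nat_recl // expr0 scale1r.
have -> : col_sum c 0 = 1 by rewrite /col_sum /= big_seq1 [LHS]big_nil.
congr (_ + _).
(* The added term has words of length [N.+1] and vanishes; the range then matches that of
   [col_series]. *)
have -> : \sum_(0 <= k < N) z ^+ k.+1 *: col_sum c k.+1 =
         \sum_(0 <= k < N.+1) z ^+ k.+1 *: col_sum c k.+1.
  by rewrite [RHS]big_nat_recr //= col_sum_nil // scaler0 addr0.
under eq_bigr do rewrite col_sumS scaler_sumr.
rewrite exchange_big /=; apply: eq_bigr => a _.
rewrite mulr_suml scaler_sumr; apply: eq_bigr => k _.
by rewrite -scalerAl scalerA exprS.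
Qed.

Lemma rev_col_series_rec z c :
  rev_col_series z c = 1 + \sum_(0 <= a < m | (c <= a.+1)%N) z *: (X a * rev_col_series z a).
Proof.
rewrite /rev_col_series big_nat_recl // expr0 scale1r.
have -> : rev_col_sum c 0 = 1 by rewrite /rev_col_sum /= big_seq1 [LHS]big_nil.
congr (_ + _).
have -> : \sum_(0 <= k < N) z ^+ k.+1 *: rev_col_sum c k.+1 =
         \sum_(0 <= k < N.+1) z ^+ k.+1 *: rev_col_sum c k.+1.
  by rewrite [RHS]big_nat_recr //= rev_col_sum_nil // scaler0 addr0.
under eq_bigr do rewrite rev_col_sumS scaler_sumr.
rewrite exchange_big /=; apply: eq_bigr => a _.
rewrite mulr_sumr scaler_sumr; apply: eq_bigr => k _.
by rewrite -scalerAr scalerA exprS.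
Qed.

Lemma sum_ge_step (F : nat -> A) c : (c < m)%N ->
  \sum_(0 <= a < m | (c.+1 <= a.+1)%N) F a =
  F c + \sum_(0 <= a < m | (c.+2 <= a.+1)%N) F a.
Proof.
move=> cm; rewrite !big_mkord (bigD1 (Ordinal cm)) //=; congr (_ + _).
by apply: eq_bigl => a; rewrite -val_eqE /= !ltnS ltn_neqAle andbC eq_sym.
Qed.

(** Raising the bound from [c.+1] to [c.+2] removes only the words ending in [c], that is
    [z *: (col_series z c * X c)]: this is the recurrence of [chain_sum (- z)]. *)
Lemma col_seriesE z c : (c <= m.+1)%N -> col_series z c = col_series z 0 * chain_sum (- z) c.
Proof.
have [n le] := ubnP c; elim: n c le => // n IH [|[|c]] le cm; rewrite ?chain_sum0 ?chain_sum1 ?mulr1 //.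
  by rewrite [LHS]col_series_rec [RHS]col_series_rec.
rewrite chain_sumSS mulrDr -IH // 1?ltnW // scaleNr mulrN -scalerAr mulrA -IH //; first last.
- by rewrite ltnW // ltnW.
- by rewrite ltnS in le; rewrite ltnW.
rewrite [col_series z c.+1]col_series_rec sum_ge_step //.
by rewrite [1 + _]addrCA [RHS]addrC addKr -col_series_rec.
Qed.

Lemma rev_col_seriesE z c : (c <= m.+1)%N -> rev_col_series z c = chain_sum (- z) c * rev_col_series z 0.
Proof.
have [n le] := ubnP c; elim: n c le => // n IH [|[|c]] le cm; rewrite ?chain_sum0 ?chain_sum1 ?mul1r //.
  by rewrite [LHS]rev_col_series_rec [RHS]rev_col_series_rec.
rewrite chain_sumSS mulrDl -IH // 1?ltnW // scaleNr mulNr chain_sum_X // -scalerAl -mulrA -IH //; first last.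
- by rewrite ltnW // ltnW.
- by rewrite ltnS in le; rewrite ltnW.
rewrite [rev_col_series z c.+1]rev_col_series_rec sum_ge_step //.
by rewrite [1 + _]addrCA [RHS]addrC addKr -rev_col_series_rec.
Qed.

(** The bound [m.+1] admits no last letter below [m], so only the empty word survives. *)
Lemma col_series_chain_sum z : col_series z 0 * chain_sum (- z) m.+1 = 1.
Proof.
rewrite -col_seriesE // col_series_rec big_nat_cond big1 ?addr0 // => a /andP[/andP[_ am] ma].
by move: (leq_trans ma am); rewrite ltnn.
Qed.

Lemma chain_sum_rev_col_series z : chain_sum (- z) m.+1 * rev_col_series z 0 = 1.
Proof.
rewrite -rev_col_seriesE // rev_col_series_rec big_nat_cond big1 ?addr0 // => a /andP[/andP[_ am] ma].
by move: (leq_trans ma am); rewrite ltnn.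
Qed.

(** A left inverse and a right inverse of [chain_sum (- z) m.+1] coincide. *)
Lemma col_series_rev z : col_series z 0 = rev_col_series z 0.
Proof. by rewrite -[LHS]mulr1 -(chain_sum_rev_col_series z) mulrA col_series_chain_sum mul1r. Qed.

Lemma inv_comm (a b a' b' : A) : a' * a = 1 -> a * a' = 1 -> b' * b = 1 -> b * b' = 1 ->
  a * b = b * a -> a' * b' = b' * a'.
Proof.
move=> a'a aa' b'b bb' ab.
have r : (a * b) * (b' * a') = 1 by rewrite mulrA -[a * b * b']mulrA bb' mulr1.
by rewrite -[LHS]mulr1 -r ab !mulrA -[a' * b' * b]mulrA b'b mulr1 a'a mul1r.
Qed.

Lemma col_series_comm x y : col_series x 0 * col_series y 0 = col_series y 0 * col_series x 0.
Proof.
apply: (@inv_comm (chain_sum (- x) m.+1) (chain_sum (- y) m.+1));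
  try exact: col_series_chain_sum; try exact: chain_sum_comm.
  by rewrite col_series_rev; exact: chain_sum_rev_col_series.
by rewrite col_series_rev; exact: chain_sum_rev_col_series.
Qed.

(* [tab_num x y T] is [(x - y) s_{lambda(T)'}(x, y)], the numerator of the
   bialternant formula. *)
Definition tab_num (x y : K) (T : seq (seq nat)) : K :=
  let b := count (fun R => size R == 2) T in
  x ^+ (size T).+1 * y ^+ b - x ^+ b * y ^+ (size T).+1.

Definition tab_sum x y c d :=
  \sum_(0 <= k < N.+1) \sum_(T <- col_tableaux m k c d) tab_num x y T *: word_prod (flatten (rev T)).

Definition chain_det x y c d :=
  x *: (chain_sum (- y) d * chain_sum (- x) c) - y *: (chain_sum (- x) d * chain_sum (- y) c).

Lemma tab_num_singles x y (w : seq nat) :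
  tab_num x y [seq [:: a] | a <- rev w] = x ^+ (size w).+1 - y ^+ (size w).+1.
Proof.
rewrite /tab_num size_map size_rev count_map (eq_count (a2 := pred0)) // count_pred0.
by rewrite !expr0 mulr1 mul1r.
Qed.

Lemma tab_num_cons2 x y e f T : tab_num x y ([:: e; f] :: T) = (x * y) * tab_num x y T.
Proof. by rewrite /tab_num /= add1n !exprSr mulrBr; congr (_ - _); rewrite mulrACA mulrC. Qed.

Lemma tab_sum_S x y k c d :
  \sum_(T <- col_tableaux m k.+1 c d) tab_num x y T *: word_prod (flatten (rev T)) =
  (x ^+ k.+2 - y ^+ k.+2) *: col_sum c k.+1 +
  \sum_(0 <= f < m | (d <= f.+1)%N) \sum_(0 <= e < m | (c <= e.+1)%N && (e.+2 <= f)%N)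
    (x * y) *: ((\sum_(T <- col_tableaux m k e f) tab_num x y T *: word_prod (flatten (rev T)))
                 * (X e * X f)).
Proof.
rewrite [col_tableaux m k.+1 c d]/= big_cat; congr (_ + _).
  rewrite big_map /col_sum scaler_sumr big_seq [RHS]big_seq; apply: eq_bigr => w wk.
  by rewrite tab_num_singles flatten_singles (@size_col_words m k.+1 c w wk).
rewrite big_allpairs_dep big_allpairs_dep big_filter /index_iota subn0.
apply: eq_bigr => f _; rewrite big_filter; apply: eq_bigr => e _.
rewrite mulr_suml scaler_sumr; apply: eq_bigr => T _.
rewrite tab_num_cons2 rev_cons flatten_rcons word_prod_cat !word_prod_cons [word_prod [::]]big_nil mulr1.
by rewrite -scalerAl scalerA.
Qed.

(** One-column tableaux give the first term. Otherwise the top row [[:: e; f]] is read last,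
    contributing [X e * X f] on the right, and multiplies [tab_num] by [x * y]. *)
Lemma tab_sum_rec x y c d :
  tab_sum x y c d = (x *: col_series x c - y *: col_series y c) +
  \sum_(0 <= f < m | (d <= f.+1)%N) \sum_(0 <= e < m | (c <= e.+1)%N && (e.+2 <= f)%N)
    (x * y) *: (tab_sum x y e f * (X e * X f)).
Proof.
pose S k c d := \sum_(T <- col_tableaux m k c d) tab_num x y T *: word_prod (flatten (rev T)).
(* A tableau with at least [N] letters followed by two more exceeds the length [N]. *)
have SN e f : S N e f * (X e * X f) = 0.
  rewrite mulr_suml big_seq big1 // => T /col_tableaux_leq le.
  rewrite -scalerAl; have -> : X e * X f = word_prod [:: e; f].
    by rewrite !word_prod_cons [word_prod [::]]big_nil mulr1.
  by rewrite -word_prod_cat word_prod_nil ?scaler0 // size_cat addn2 ltnW.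
have -> : x *: col_series x c - y *: col_series y c =
    \sum_(0 <= k < N.+1) (x ^+ k.+1 - y ^+ k.+1) *: col_sum c k.
  rewrite !scaler_sumr -sumrB; apply: eq_bigr => k _.
  by rewrite !scalerA -!exprS -scalerBl.
rewrite /tab_sum big_nat_recl // [in RHS]big_nat_recl // -addrA; congr (_ + _).
  rewrite /col_sum /= !big_seq1 /tab_num /= !mulr1 mul1r.
  by rewrite /word_prod big_nil.
under eq_bigr do rewrite tab_sum_S.
rewrite big_split; congr (_ + _); rewrite exchange_big; apply: eq_bigr => f _.
rewrite exchange_big; apply: eq_bigr => e _ /=.
rewrite mulr_suml scaler_sumr [RHS]big_nat_recr //=.
by rewrite [X in _ + _ *: X]SN scaler0 addr0.
Qed.

(** The sum over [e] telescopes, as [x *: (chain_sum (- x) e * X e)] is the difference of two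
    consecutive chain sums; the products left at the end [f] cancel by [chain_sum_comm]. *)
Lemma sum_chain_det x y c f : (c <= f <= m)%N ->
  \sum_(0 <= e < m | (c <= e.+1)%N && (e.+2 <= f)%N) chain_det x y e f * X e =
  chain_sum (- y) f * chain_sum (- x) c - chain_sum (- x) f * chain_sum (- y) c.
Proof.
case/andP=> cf fm; have [n le] := ubnP (f - c); elim: n c le cf => // n IH c le cf.
move: (cf); rewrite leq_eqVlt => /predU1P[->|{}cf].
  rewrite chain_sum_comm subrr big1 // => e /andP[e1 e2].
  by move: (leq_trans e2 e1); rewrite ltnn.
have {}IH : \sum_(0 <= e < m | (c.+1 <= e.+1)%N && (e.+2 <= f)%N) chain_det x y e f * X e =
  chain_sum (- y) f * chain_sum (- x) c.+1 - chain_sum (- x) f * chain_sum (- y) c.+1.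
  by apply: IH => //; rewrite subnS prednK ?subn_gt0.
case: c cf IH {le} => [|c] cf; first by rewrite !chain_sum0 !chain_sum1.
rewrite big_mkcondr => IH; rewrite big_mkcondr sum_ge_step; last exact: ltn_trans (ltnSn c) (leq_trans cf fm).
rewrite cf IH !chain_sumSS /chain_det mulrBl !scaleNr !mulrBr -!scalerAl -!scalerAr -!mulrA opprB.
exact: subr_add4.
Qed.

(** Downward induction on [d]: lowering [d] from [f.+2] to [f.+1] adds exactly the inner sum for
    [f], evaluated by [sum_chain_det]. *)
Lemma chain_det_rec x y c d : (c < d <= m.+1)%N ->
  chain_det x y c d = chain_det x y c m.+1 +
  \sum_(0 <= f < m | (d <= f.+1)%N) \sum_(0 <= e < m | (c <= e.+1)%N && (e.+2 <= f)%N)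
    (x * y) *: (chain_det x y e f * (X e * X f)).
Proof.
case/andP=> cd dm; have [n le] := ubnP (m.+1 - d); elim: n d le cd dm => // n IH [|f] le cf fm //.
move: (fm); rewrite ltnS leq_eqVlt => /predU1P[->|{}fm].
  rewrite [X in _ + X]big_nat_cond big1 ?addr0 // => a /andP[/andP[_ am] ma].
  by move: (leq_trans ma am); rewrite ltnn.
rewrite sum_ge_step // addrCA -IH //; first last.
- exact: leqW.
- by rewrite ltnS subSS in le *; rewrite -ltnS subnSK // (leq_trans _ le).
have -> : \sum_(0 <= e < m | (c <= e.+1)%N && (e.+2 <= f)%N) (x * y) *: (chain_det x y e f * (X e * X f))
  = (x * y) *: ((chain_sum (- y) f * chain_sum (- x) c - chain_sum (- x) f * chain_sum (- y) c) * X f).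
  rewrite -sum_chain_det; last by rewrite -ltnS cf ltnW.
  by rewrite mulr_suml scaler_sumr; apply: eq_bigr => e _; rewrite mulrA.
rewrite /chain_det !chain_sumSS !scaleNr !mulrBl -!scalerAl -!mulrA -!chain_sum_X //.
rewrite !mulrA !scalerBr !scalerA.
by rewrite [y * x]mulrC opprB subr_add4.
Qed.

Lemma col_series_chain_det x y c : (c <= m.+1)%N ->
  col_series x 0 * col_series y 0 * chain_det x y c m.+1 = x *: col_series x c - y *: col_series y c.
Proof.
move=> cm; rewrite /chain_det mulrBr -!scalerAr; congr (_ *: _ - _ *: _).
  by rewrite !mulrA -[_ * col_series y 0 * _]mulrA col_series_chain_sum mulr1 -col_seriesE.
by rewrite col_series_comm !mulrA -[_ * col_series x 0 * _]mulrA col_series_chain_sum mulr1 -col_seriesE.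
Qed.

(** Both sides satisfy the same recursion, whose solution is unique because long words vanish. *)
Lemma tab_sumE x y c d : (c < d <= m.+1)%N ->
  tab_sum x y c d = col_series x 0 * col_series y 0 * chain_det x y c d.
Proof.
(* The difference is tested against words [w] on the right; each unfolding of the recursion prepends
   two letters to [w], until the product vanishes. *)
suff H n : (n <= N.+1)%N -> forall w c d, (N < size w + n)%N -> (c < d <= m.+1)%N ->
    (tab_sum x y c d - col_series x 0 * col_series y 0 * chain_det x y c d) * word_prod w = 0.
  move=> cd; apply/eqP; rewrite -subr_eq0 -[X in X == 0]mulr1.
  by have /eqP := H N.+1 (leqnn _) [::] c d (ltnSn N) cd; rewrite [word_prod [::]]big_nil.
elim: n => [|n IH] nN w {c d} c d; first by rewrite addn0 => Nw _; rewrite word_prod_nil ?mulr0.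
move=> Nw cd; rewrite tab_sum_rec chain_det_rec // mulrDr col_series_chain_det; last first.
  by case/andP: cd => c1 c2; rewrite (leq_trans (ltnW c1)).
rewrite opprD addrACA subrr add0r mulr_sumr -sumrB mulr_suml big_nat_cond big1 // => f.
case/andP => /andP[_ fm] df.
rewrite mulr_sumr -sumrB mulr_suml big1 // => e /andP[ce ef].
rewrite -scalerAr [X in _ - _ *: X]mulrA -scalerBr -scalerAl -mulrBl -[_ * _ * word_prod w]mulrA.
rewrite -[X e * X f * word_prod w]mulrA -!word_prod_cons.
rewrite IH ?scaler0 //=; first exact: ltnW.
  by rewrite !addSn ltnW // ltnS -addnS.
by rewrite (ltn_trans _ ef) // ltnW // ltnW.
Qed.

(** The second factor is put in reversed form to match the words [w ++ rev u]. *)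
Lemma tab_sum_cauchy x y : tab_sum x y 0 1 = (x - y) *: (col_series x 0 * rev_col_series y 0).
Proof.
rewrite tab_sumE //.
by rewrite /chain_det !chain_sum0 !chain_sum1 !mulr1 -scalerBl -scalerAr mulr1 [col_series y 0]col_series_rev.
Qed.

End QuantumAlgebra.

(** * A representation computing area and dinv *)

Section LinearOperators.
Variables (K : comNzRingType) (S : pointedType).

(** These form an algebra under composition; the base point of [S] provides [1 != 0]. *)
Record operator := Operator {
  op_fun :> (S -> K) -> S -> K;
  op_linear : forall a g h,
    op_fun (fun s => a * g s + h s) = (fun s => a * op_fun g s + op_fun h s) }.

Lemma operatorP (f g : operator) : (forall v s, f v s = g v s) -> f = g.
Proof.
case: f g => f fl [g gl] /= fg; have eq_fg : f = g by apply/funext => v; apply/funext => s.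
by case: g / eq_fg gl {fg} => gl; congr Operator; exact: Prop_irrelevance.
Qed.

HB.instance Definition _ := gen_eqMixin operator.
HB.instance Definition _ := gen_choiceMixin operator.

Lemma op_lin (f : operator) a g h s :
  f (fun s => a * g s + h s) s = a * f g s + f h s.
Proof. by rewrite op_linear. Qed.

Lemma op_fun0 (f : operator) s : f (fun=> 0) s = 0.
Proof.
have e : - 1 * f (fun=> 0) s + f (fun=> 0) s = 0 by rewrite mulN1r addNr.
rewrite -[RHS]e -op_lin; congr (op_fun f _ s).
by apply/funext => s'; rewrite mulr0 addr0.
Qed.

Lemma op_funZ (f : operator) a g s : f (fun s => a * g s) s = a * f g s.
Proof.
rewrite -[RHS]addr0 -(op_fun0 f s) -op_lin; congr (op_fun f _ s).
by apply/funext => s'; rewrite addr0.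
Qed.

Lemma op_add_linear (f g : operator) a u v :
  (fun w s => f w s + g w s) (fun s => a * u s + v s) =
  (fun s => a * (f u s + g u s) + (f v s + g v s)).
Proof. by apply/funext => s; rewrite !op_lin mulrDr addrACA. Qed.

Lemma op_opp_linear (f : operator) a u v :
  (fun w s => - f w s) (fun s => a * u s + v s) = (fun s => a * - f u s + - f v s).
Proof. by apply/funext => s; rewrite !op_lin opprD mulrN. Qed.

Lemma op_zero_linear a (u v : S -> K) :
  (fun _ _ => 0) (fun s => a * u s + v s) = (fun s : S => a * 0 + 0) :> (S -> K).
Proof. by apply/funext => s; rewrite mulr0 addr0. Qed.

Lemma op_scale_linear b (f : operator) a u v :
  (fun w s => b * f w s) (fun s => a * u s + v s) =
  (fun s => a * (b * f u s) + b * f v s).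
Proof. by apply/funext => s; rewrite !op_lin mulrDr mulrCA. Qed.

Lemma op_comp_linear (f g : operator) a u v :
  (fun w => f (g w)) (fun s => a * u s + v s) = (fun s => a * f (g u) s + f (g v) s).
Proof. by rewrite -op_linear op_linear. Qed.

Lemma op_id_linear a (u v : S -> K) :
  id (fun s => a * u s + v s) = (fun s => a * id u s + id v s).
Proof. by []. Qed.

Definition op_add f g := Operator (op_add_linear f g).
Definition op_opp f := Operator (op_opp_linear f).
Definition op_zero := Operator op_zero_linear.
Definition op_scale b f := Operator (op_scale_linear b f).
Definition op_comp f g := Operator (op_comp_linear f g).
Definition op_id := Operator op_id_linear.

Fact op_addA : associative op_add.
Proof. by move=> f g h; apply: operatorP => v s /=; rewrite addrA. Qed.
Fact op_addC : commutative op_add.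
Proof. by move=> f g; apply: operatorP => v s /=; rewrite addrC. Qed.
Fact op_add0 : left_id op_zero op_add.
Proof. by move=> f; apply: operatorP => v s /=; rewrite add0r. Qed.
Fact op_addN : left_inverse op_zero op_opp op_add.
Proof. by move=> f; apply: operatorP => v s /=; rewrite addNr. Qed.
HB.instance Definition _ := GRing.isZmodule.Build operator op_addA op_addC op_add0 op_addN.

Fact op_compA : associative op_comp.
Proof. by move=> f g h; apply: operatorP. Qed.
Fact op_comp1 : left_id op_id op_comp.
Proof. by move=> f; apply: operatorP. Qed.
Fact op_compr1 : right_id op_id op_comp.
Proof. by move=> f; apply: operatorP. Qed.
Fact op_compDl : left_distributive op_comp op_add.
Proof. by move=> f g h; apply: operatorP. Qed.
Fact op_compDr : right_distributive op_comp op_add.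
Proof.
move=> f g h; apply: operatorP => v s /=.
rewrite -[f (g v) s]mul1r -op_lin; congr (op_fun f _ s).
by apply/funext => s'; rewrite mul1r.
Qed.
Fact op_1_neq0 : op_id != op_zero.
Proof.
apply/eqP => /(congr1 (fun f : operator => f (fun=> 1) point)) /= /eqP.
by rewrite oner_eq0.
Qed.
HB.instance Definition _ := GRing.Zmodule_isNzRing.Build operator
  op_compA op_comp1 op_compr1 op_compDl op_compDr op_1_neq0.

Fact op_scaleA a b f : op_scale a (op_scale b f) = op_scale (a * b) f.
Proof. by apply: operatorP => v s /=; rewrite mulrA. Qed.
Fact op_scale1 : left_id 1 op_scale.
Proof. by move=> f; apply: operatorP => v s /=; rewrite mul1r. Qed.
Fact op_scaleDr : right_distributive op_scale +%R.
Proof. by move=> a f g; apply: operatorP => v s /=; rewrite mulrDr. Qed.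
Fact op_scaleDl f : {morph op_scale^~ f : a b / a + b}.
Proof. by move=> a b; apply: operatorP => v s /=; rewrite mulrDl. Qed.
HB.instance Definition _ := GRing.Zmodule_isLmodule.Build K operator
  op_scaleA op_scale1 op_scaleDr op_scaleDl.
Fact op_scaleAl (a : K) (f g : operator) : a *: (f * g) = a *: f * g.
Proof. exact: operatorP. Qed.
HB.instance Definition _ := GRing.Lmodule_isLalgebra.Build K operator op_scaleAl.
Fact op_scaleAr (a : K) (f g : operator) : a *: (f * g) = f * (a *: g).
Proof.
apply: operatorP => v s /=.
exact: esym (op_funZ _ _ _ _).
Qed.
HB.instance Definition _ := GRing.Lalgebra_isAlgebra.Build K operator op_scaleAr.

Lemma op_scaleE a (f : operator) v s : (a *: f) v s = a * f v s.
Proof. by []. Qed.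
Lemma op_mulE (f g : operator) v s : (f * g) v s = f (g v) s.
Proof. by []. Qed.
Lemma op_sumE (I : Type) (r : seq I) (P : pred I) (F : I -> operator) v s :
  (\sum_(i <- r | P i) F i) v s = \sum_(i <- r | P i) F i v s.
Proof. by apply: (big_morph (fun f : operator => f v s)). Qed.
End LinearOperators.
Arguments Operator {K S}.

Section CountOperators.
Variables (K : comNzRingType) (q t : K) (N : nat).

(* A state counts how often each letter has been read.  The total number of
   letters read is also kept so that words longer than [N] act as 0, which makes
   the series of column words finite. *)
Definition state : Type := (nat -> nat) * nat.
HB.instance Definition _ := Pointed.copy state ((nat -> nat) * nat)%type.

Definition read (a : nat) (n : nat -> nat) : nat -> nat := fun i => (n i + (i == a))%N.

(** A newly read [a] forms a pair with each earlier [a] and [a.+1], whence the exponent of [t]. In a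
    product the leftmost letter is read first. *)
Definition read_op a (g : state -> K) (s : state) : K :=
  if (s.2 < N)%N then q ^+ a * t ^+ (s.1 a + s.1 a.+1) * g (read a s.1, s.2.+1) else 0.

Lemma read_linear a (c : K) (u v : state -> K) :
  read_op a (fun s => c * u s + v s) = (fun s => c * read_op a u s + read_op a v s).
Proof.
rewrite /read_op; apply/funext => s; case: ifP => _; first by rewrite mulrDr mulrCA.
by rewrite mulr0 addr0.
Qed.

Definition letter_op a : operator K state := Operator _ (read_linear a).

Lemma letter_opE a g n l : letter_op a g (n, l) =
  if (l < N)%N then q ^+ a * t ^+ (n a + n a.+1) * g (read a n, l.+1) else 0.
Proof. by []. Qed.

Lemma read_comm a b n : read a (read b n) = read b (read a n).
Proof. by apply/funext => i; rewrite /read addnAC. Qed.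

Lemma letter_op2E a b g n l : (letter_op a * letter_op b) g (n, l) =
  if (l.+1 < N)%N then
    q ^+ (a + b) * t ^+ (n a + n a.+1 + (read a n b + read a n b.+1)) *
      g (read b (read a n), l.+2)
  else 0.
Proof.
rewrite op_mulE !letter_opE; case: ifP => [lN|lN]; last first.
  by case: ifP => // /ltnW; rewrite lN.
by case: ifP => _; rewrite ?mulr0 // !exprD mulrA; congr (_ * _); rewrite mulrACA.
Qed.

Lemma letter_op_far a b : (a.+2 <= b)%N -> letter_op a * letter_op b = letter_op b * letter_op a.
Proof.
move=> ab; apply: operatorP => g [n l]; rewrite !letter_op2E.
have nab : (a == b) = false by apply/negbTE; rewrite neq_ltn (ltn_trans _ ab).
have naSb : (a == b.+1) = false.
  by apply/negbTE; rewrite neq_ltn (ltn_trans (ltnSn a)) // ltnW // ltnW.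
have nSab : (a.+1 == b) = false by apply/negbTE; rewrite neq_ltn ab.
rewrite addnC read_comm /read [b == a]eq_sym [b.+1 == a]eq_sym.
by rewrite nab naSb nSab !addn0 [(_ + _ + (_ + _))%N]addnC.
Qed.

(** Reading [a.+1] before [a] creates one more pair than the opposite order. *)
Lemma letter_op_near a : letter_op a.+1 * letter_op a = t *: (letter_op a * letter_op a.+1).
Proof.
apply: operatorP => g [n l]; rewrite op_scaleE !letter_op2E.
case: ifP => _; rewrite ?mulr0 // addnC read_comm !mulrA; congr (_ * _).
rewrite [t * _]mulrC -mulrA -exprS; congr (_ * t ^+ _).
rewrite /read eqxx; lia.
Qed.

Definition word_op (w : seq nat) : operator K state := \prod_(a <- w) letter_op a.

Definition count_fun (s : seq nat) : nat -> nat := fun a => count_mem a s.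

(** The factor [t ^+ dinv s] accounts for the prefix without dividing. The empty word is a separate
    case because it reads no letter and so never tests the bound [N]. *)
Lemma word_opE w s g :
  t ^+ dinv s * word_op w g (count_fun s, size s) =
  if (w == [::]) || (size s + size w <= N)%N then
    q ^+ area w * t ^+ dinv (s ++ w) * g (count_fun (s ++ w), size (s ++ w)) else 0.
Proof.
elim: w s => [|a w IH] s; first by rewrite /word_op big_nil cats0 /= expr0 mul1r.
rewrite /word_op big_cons op_mulE letter_opE -/(word_op w).
have eq_state : (read a (count_fun s), (size s).+1) = (count_fun (rcons s a), size (rcons s a)).
  rewrite size_rcons; congr (_, _); apply/funext => i.
  by rewrite /read /count_fun -cats1 count_cat /= addn0 eq_sym.
have dinv_rcons : dinv (rcons s a) = (dinv s + (count_fun s a + count_fun s a.+1))%N.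
  by rewrite -cats1 dinv_insert cats0 !addn0.
case: ifP => [sN|sN]; last first.
  rewrite mulr0 ifF //=; apply/negbTE; move/negbT: sN; lia.
rewrite mulrA [t ^+ dinv s * _]mulrCA -exprD -dinv_rcons -[LHS]mulrA eq_state IH.
rewrite size_rcons addSnnS cat_rcons /=; case: (w =P [::]) => [->|_] /=; last first.
  by case: ifP; rewrite ?mulr0 // !mulrA exprD.
by rewrite addn1 sN !mulrA exprD.
Qed.

Lemma word_op_nil w : (N < size w)%N -> word_op w = 0.
Proof.
have H a w' l : (N <= size w' + l)%N -> forall g n, word_op (a :: w') g (n, l) = 0.
  elim: w' a l => [|b w' IH] a l Nl g n; rewrite /word_op big_cons op_mulE letter_opE; case: ifP => // lN.
    by move: (leq_trans lN Nl); rewrite add0n ltnn.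
  by rewrite [X in _ * X]IH ?mulr0 // addnS -addSn.
case: w => // a w Nw; apply: operatorP => g [n l]; apply: H.
by rewrite (leq_trans _ (leq_addr _ _)).
Qed.

End CountOperators.

(** * The generating functions *)

Local Open Scope classical_set_scope.

Lemma schur2_sum la (L : seq nat) (f : nat -> seq (seq nat)) : uniq L ->
  (forall i j, i \in L -> j \in L -> f i = f j -> i = j) ->
  (forall T, is_ssyt 2 la T <-> exists2 i, i \in L & T = f i) ->
  schur 2 la = \sum_(i <- L) q ^+ count_mem 0%N (flatten (f i)) * t ^+ count_mem 1%N (flatten (f i)).
Proof.
move=> uL f_inj LP; rewrite /schur.
have -> : [set T | is_ssyt 2 la T] = [set` [seq f i | i <- L]].
  apply/seteqP; split=> T /=.
    by move=> /LP[i iL ->]; exact: map_f.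
  by move=> /mapP[i iL ->]; apply/LP; exists i.
rewrite -fsbig_seq ?map_inj_in_uniq // big_map; apply: eq_bigr => i _.
by rewrite big_ord_recl big_ord1.
Qed.

(** A geometric sum, once [t ^+ b * q ^+ b] is factored out. *)
Lemma sum_two_powers (a b : nat) : (b <= a)%N ->
  (t - q) * (\sum_(i <- iota b (a - b).+1) q ^+ i * t ^+ (a - i + b)) =
  t ^+ a.+1 * q ^+ b - t ^+ b * q ^+ a.+1.
Proof.
move=> ba; have e : (a.+1 = b + (a - b).+1)%N by rewrite addnS subnKC.
transitivity (t ^+ b * q ^+ b * (t ^+ (a - b).+1 - q ^+ (a - b).+1)); last first.
  rewrite e !exprD mulrBr; congr (_ - _); first by rewrite mulrAC.
  by rewrite -mulrA.
rewrite subrXX mulrCA; congr (_ * _).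
rewrite -{1}[b]addn0 iotaDl big_map -(big_mkord xpredT (fun i => t ^+ ((a - b).+1.-1 - i) * q ^+ i)).
rewrite mulr_sumr /index_iota subn0; apply: eq_big_seq => j; rewrite mem_iota /= add0n ltnS => jab.
have -> : (a - (b + j) + b = b + (a - b - j))%N by rewrite addnC subnDA.
by rewrite !exprD mulrACA [q ^+ b * _]mulrC [q ^+ j * _]mulrC.
Qed.

(** The tableaux of the conjugate shape are indexed by the number [i] of 0s in the first row, and
    [sum_two_powers] sums their weights. *)
Lemma schur_tab_num (T : seq (seq nat)) : [::] \notin T -> all (fun R => (size R <= 2)%N) T ->
  sorted geq (map size T) ->
  (t - q) * schur 2 (conj_partition (shape_of T)) = tab_num t q T.
Proof.
move=> T0 T2 st; rewrite conj_two_columns // /tab_num.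
case: T T0 T2 st => [|R T] T0 T2 st; last first.
  set b := count _ _; have ba : (b <= size (R :: T))%N by exact: count_size.
  have inj1 i j : (i <= size (R :: T))%N -> (j <= size (R :: T))%N -> bit_row (size (R :: T)) i =
      bit_row (size (R :: T)) j -> i = j.
    by move=> ia ja /(congr1 (count_mem 0%N)); rewrite !count_bit_row.
  rewrite -sum_two_powers //; move: (size (R :: T)) ba inj1 => a ba inj1.
  have [b0|b_gt0] := posnP b.
    rewrite b0 subn0 (@schur2_sum _ (iota 0 a.+1) (fun i => [:: bit_row a i])).
    - congr (_ * _); apply: eq_big_seq => i; rewrite mem_iota /= add0n ltnS => ia.
      by rewrite cats0 !count_bit_row // addn0.
    - exact: iota_uniq.
    - by move=> i j; rewrite !mem_iota /= !add0n !ltnS => ia ja [/inj1]; apply.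
    - move=> V; split=> [/is_ssyt1[i ia ->]|[i]].
        by exists i; rewrite ?mem_iota.
      by rewrite mem_iota => ia ->; apply/is_ssyt1; exists i.
  rewrite (@schur2_sum _ (iota b (a - b).+1) (fun i => [:: bit_row a i; nseq b 1%N])).
  - congr (_ * _); apply: eq_big_seq => i; rewrite mem_iota addnS ltnS subnKC // => /andP[bi ia].
    by rewrite /= cats0 !(count_cat _ (bit_row a i)) !count_bit_row // !count_nseq /= mul0n mul1n addn0.
  - exact: iota_uniq.
  - move=> i j; rewrite !mem_iota addnS !ltnS subnKC // => /andP[_ ia] /andP[_ ja] [/inj1]; exact.
  - move=> V; split=> [/(is_ssyt2 _ ba)[i ia ->]|[i]].
      by exists i; rewrite ?mem_iota ?addnS ?ltnS ?subnKC.
    by rewrite mem_iota addnS ltnS subnKC // => ia ->; apply/(is_ssyt2 _ ba); exists i.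
(* The empty shape has a single tableau, so any one-element index list serves. *)
rewrite (@schur2_sum _ [:: 0%N] (fun=> [::])) //=.
- by rewrite big_seq1 !expr0 !mulr1 mul1r !expr1.
- by move=> i j; rewrite !inE => /eqP -> /eqP ->.
- move=> V; split=> [/and4P[]|[i _ ->]] //.
  by case: V => // _ _ _ _; exists 0%N.
Qed.

Lemma big_all_col_words (R : nmodType) n m (G : seq nat -> R) :
  \sum_(w <- all_col_words n m) G w =
  \sum_(0 <= k < n.+1) \sum_(w <- col_words m k 0) G w.
Proof. by rewrite big_flatten big_map /index_iota subn0. Qed.

Lemma big_all_col_tableaux (R : nmodType) n m (G : seq (seq nat) -> R) :
  \sum_(w <- all_col_tableaux n m) G w =
  \sum_(0 <= k < n.+1) \sum_(w <- col_tableaux m k 0 1) G w.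
Proof. by rewrite big_flatten big_map /index_iota subn0. Qed.

(** The operator identity [tab_sum_cauchy], applied to a test function and evaluated at the state
    reached after reading [F]. *)
Lemma tableaux_column_pairs (K : comNzRingType) (x y : K) (n m : nat) (F : seq nat) :
  \sum_(T <- all_col_tableaux n m | (size F + size (RR T) == n)%N)
    tab_num y x T * (x ^+ area (RR T) * y ^+ dinv (F ++ RR T)) =
  (y - x) * (\sum_(w <- all_col_words n m)
    \sum_(u <- all_col_words n m | (size F + size (w ++ rev u) == n)%N)
      y ^+ size w * x ^+ size u * (x ^+ area (w ++ rev u) * y ^+ dinv (F ++ w ++ rev u))).
Proof.
(* The test function keeps the words that complete [F] to total length [n]. *)
pose g : state -> K := fun s => (s.2 == n)%:R.
pose V w := y ^+ dinv F * word_op x y n w g (count_fun F, size F).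
have VE w : V w = if (size F + size w == n)%N then x ^+ area w * y ^+ dinv (F ++ w) else 0.
  rewrite /V word_opE /g /= size_cat.
  case: (size F + size w =P n)%N => [->|_]; first by rewrite leqnn orbT mulr1.
  by rewrite mulr0 if_same.
have main := @tab_sum_cauchy _ _ _ _ (@letter_op_far K x y n)
  (@letter_op_near K x y n) n m (@word_op_nil K x y n) y x.
have := congr1 (fun f : operator K state => y ^+ dinv F * f g (count_fun F, size F)) main.
rewrite op_scaleE mulrCA => {}main.
transitivity (\sum_(T <- all_col_tableaux n m) tab_num y x T * V (RR T)).
  by rewrite [LHS]big_mkcond; apply: eq_bigr => T _; rewrite VE; case: ifP; rewrite ?mulr0.
transitivity ((y - x) * \sum_(w <- all_col_words n m) \sum_(u <- all_col_words n m)
    y ^+ size w * x ^+ size u * V (w ++ rev u)); last first.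
  congr (_ * _); apply: eq_bigr => w _; rewrite [RHS]big_mkcond; apply: eq_bigr => u _.
  by rewrite VE; case: ifP; rewrite ?mulr0.
have <- : y ^+ dinv F * tab_sum (letter_op x y n) n m y x 0 1 g (count_fun F, size F) =
    \sum_(T <- all_col_tableaux n m) tab_num y x T * V (RR T).
  rewrite big_all_col_tableaux /tab_sum op_sumE mulr_sumr; apply: eq_bigr => k _.
  rewrite op_sumE mulr_sumr; apply: eq_bigr => T _.
  by rewrite op_scaleE mulrCA.
rewrite main; congr (_ * _); rewrite /col_series /rev_col_series mulr_suml op_sumE mulr_sumr.
rewrite big_all_col_words.
apply: eq_bigr => k _; rewrite /col_sum scaler_sumr mulr_suml op_sumE mulr_sumr.
rewrite big_seq [RHS]big_seq; apply: eq_bigr => w /size_col_words ->.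
rewrite mulr_sumr op_sumE mulr_sumr big_all_col_words; apply: eq_bigr => l _.
rewrite /rev_col_sum scaler_sumr mulr_sumr op_sumE mulr_sumr.
rewrite big_seq [RHS]big_seq; apply: eq_bigr => u /size_col_words ->.
rewrite -scalerAl -scalerAr -word_prod_cat !op_scaleE /V.
by rewrite mulrCA [X in _ * X]mulrCA -[RHS]mulrA.
Qed.

Lemma t_neq0 : t != 0.
Proof.
apply/eqP => /(congr1 (meval (fun=> 1))) /eqP.
by rewrite /t mevalXU meval0 oner_eq0.
Qed.

Lemma t_sub_q_neq0 : t - q != 0.
Proof.
apply/eqP => /(congr1 (meval (fun i : 'I_2 => (i == ord_max)%:R))) /eqP.
by rewrite mevalB /t /q !mevalXU meval0 /= subr0 oner_eq0.
Qed.

Lemma skeleton_sum (m n : nat) (F : seq nat) : is_skeleton m F ->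
  \sum_(w <- all_col_words n m)
    \sum_(u <- all_col_words n m | (size F + size (w ++ rev u) == n)%N)
      q ^+ area (build (rev u) F ++ w) * t ^+ dinv (build (rev u) F ++ w) =
  \sum_(T <- all_col_tableaux n m | (size F + size (RR T) == n)%N)
    q ^+ area (F ++ RR T) * t ^+ (dinv (F ++ RR T) - ncells T)%N *
    schur 2 (conj_partition (shape_of T)).
Proof.
move=> skF; have dF : dyck_to m F by case/dyck_to_skeleton: skF.
(* The factor [t - q] turns Schur functions into [tab_num]. Since [n - size F] is both [ncells T]
   and [size u + size w], the power of [t] removes the subtraction in the exponent and supplies the
   term [size u] of [dinv_build]. *)
apply: (mulfI t_sub_q_neq0); apply: (mulfI (expf_neq0 (n - size F)%N t_neq0)).
have := congr1 (fun z => q ^+ area F * z) (tableaux_column_pairs q t n m F).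
rewrite [RHS]mulrCA => main.
transitivity ((t - q) * (q ^+ area F * (\sum_(w <- all_col_words n m)
    \sum_(u <- all_col_words n m | (size F + size (w ++ rev u) == n)%N)
      t ^+ size w * q ^+ size u * (q ^+ area (w ++ rev u) * t ^+ dinv (F ++ w ++ rev u))))).
  rewrite mulrCA; congr (_ * _); rewrite !mulr_sumr big_seq [RHS]big_seq; apply: eq_bigr => w wW.
  rewrite !mulr_sumr big_seq_cond [RHS]big_seq_cond; apply: eq_bigr => u /andP[uW /eqP sn].
  have um : all (fun a => a < m)%N (rev u).
    by rewrite all_rev; move: uW; rewrite mem_all_col_words => /and3P[].
  have -> : (n - size F = size u + size w)%N by rewrite -sn addKn size_cat size_rev addnC.
  rewrite -(dinv_build w dF um) size_rev /area !sumn_cat -/(area (build _ _)) area_build /area size_rev.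
  rewrite !exprD; ring.
rewrite -main !mulr_sumr big_seq_cond [RHS]big_seq_cond; apply: eq_bigr => T /andP[TT /eqP sn].
have := TT; rewrite mem_all_col_tableaux => /and4P[_ dT T2 Tm].
have /and4P[T0 st _ _] := dT.
have le : (ncells T <= dinv (F ++ RR T))%N by apply: (@leq_ncells_dinv n); exists m.
rewrite -(schur_tab_num T0 T2 st) -[in LHS](subnK le) exprD.
have -> : (n - size F = ncells T)%N by rewrite -sn addKn size_RR.
by rewrite /area sumn_cat !exprD; ring.
Qed.

Unset Implicit Arguments.

Theorem theorem4p20 (n : nat) (hn : (1 <= n)%N) :
  qtCatalan n =
  \sum_(FP \in skeleton_pairs n)
    q ^+ area (FP.1 ++ RR FP.2) *
    t ^+ (dinv (FP.1 ++ RR FP.2) - ncells FP.2)%N *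
    schur 2 (conj_partition (shape_of FP.2)).
Proof.
have -> : skeleton_pairs n = [set` skeleton_pair_list n].
  by apply/seteqP; split=> FT /skeleton_pairsE.
rewrite -fsbig_seq ?uniq_skeleton_pair_list // /qtCatalan.
have -> : [set D | is_dyck D /\ size D = n] = [set` [seq dyck_of_data d | d <- dyck_data n]].
  apply/seteqP; split=> D /=.
    by case/dyck_of_dataP => d dL ->; exact: map_f.
  by case/mapP => d dL ->; apply/dyck_of_dataP; exists d.
rewrite -fsbig_seq; last by rewrite map_inj_in_uniq ?uniq_dyck_data //; exact: dyck_of_data_inj.
(* Both sums are now grouped by the skeleton [F], and agree for each [F]. *)
rewrite big_map big_allpairs_dep [RHS]big_allpairs_dep big_seq [RHS]big_seq.
apply: eq_bigr => F /mem_skeletons[_ skF].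
rewrite !big_filter -(skeleton_sum n skF) big_mkcond big_allpairs.
by apply: eq_bigr => w _; rewrite [RHS]big_mkcond.
Qed.
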